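(* There exists a constant $C_G>0$ such that for every $N\ge2$ the Green energy of every $N$-point configuration $\omega_N$ on $\mathbb{RP}^2$ satisfies $$E_G(\omega_N)\ge-\frac12N\log(N)-C_GN.$$
   Context: $\mathbb{RP}^2$ carries its isometry-invariant Riemannian metric, normalized so that its diameter is $\frac\pi2$ (i.e. the quotient of the unit sphere $\mathbb{S}^2$ by the antipodal map), and $\sigma$ is the isometry-invariant Borel probability measure. $G$ is the Green function of the Laplace–Beltrami operator $\triangle$ on $\mathbb{RP}^2$ (sign chosen so that its eigenvalues are non-negative): the kernel such that $\int G(x,y)\,d\sigma(y)=0$ and for every smooth $f$ with $\int f\,d\sigma=0$ the function $g(x)=\int G(x,y)f(y)\,d\sigma(y)$ solves $\triangle g=f$ with $\int g\,d\sigma=0$. $E_G(\omega_N)=\sum_{i\ne j}G(x_i,x_j)$ for $\omega_N=\{x_1,\dots,x_N\}$. *)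

(* Defs.v *)
From HB Require Import structures.
From mathcomp Require Import all_boot all_order all_algebra.
From mathcomp Require Import all_classical all_reals all_analysis.

Set Implicit Arguments.
Unset Strict Implicit.
Unset Printing Implicit Defensive.

Import Order.TTheory GRing.Theory Num.Theory.
Import numFieldNormedType.Exports.

Local Open Scope classical_set_scope.
Local Open Scope ring_scope.
Local Open Scope quotient_scope.

Section Smoothness.
Context {R : realType} {V W : normedModType R}.

Fixpoint iter_derive (vs : seq V) (f : V -> W) : V -> W :=
  if vs is v :: vs' then 'D_v (iter_derive vs' f) else f.

(* For finite-dimensional V and open U this is C^infinity on U; values of f
   outside U are irrelevant. *)
Definition smooth_on (U : set V) (f : V -> W) : Prop :=
  forall (vs : seq V) (x : V), U x -> differentiable (iter_derive vs f) x.

End Smoothness.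

Section ProjectivePlane.
Variable R : realType.

Definition dotp (n : nat) (x y : 'rV[R]_n) : R := \sum_(i < n) x 0 i * y 0 i.

Definition sphere2 : set 'rV[R]_3 := [set x | dotp x x = 1].

Definition S2 : Type := set_type sphere2.
HB.instance Definition _ := Topological.on S2.

Lemma sphere2_e0 : (delta_mx 0 0 : 'rV[R]_3) \in sphere2.
Proof.
rewrite inE /sphere2 /dotp /= (bigD1 0) //= big1 ?addr0 ?mxE ?mulr1 //.
by move=> i /negbTE i0; rewrite !mxE i0 mulr0.
Qed.

HB.instance Definition _ :=
  isPointed.Build S2 (exist _ (delta_mx 0 0) sphere2_e0 : S2).

Definition antipodal : rel S2 :=
  fun x y => (val x == val y) || (val x == - val y).

Lemma antipodal_refl : reflexive antipodal.
Proof. by move=> x; rewrite /antipodal eqxx. Qed.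

Lemma antipodal_sym : symmetric antipodal.
Proof. by move=> x y; rewrite /antipodal eq_sym -eqr_oppLR (eq_sym (- _)). Qed.

Lemma antipodal_trans : transitive antipodal.
Proof.
move=> y x z /orP[]/eqP exy /orP[]/eqP eyz; rewrite /antipodal exy eyz ?opprK;
  by rewrite eqxx ?orbT.
Qed.

Canonical antipodal_equiv :=
  EquivRel antipodal antipodal_refl antipodal_sym antipodal_trans.

Definition RP2 : Type := quotient_topology {eq_quot antipodal_equiv}.
HB.instance Definition _ := Topological.on RP2.
HB.instance Definition _ := Quotient.on RP2.
HB.instance Definition _ := Pointed.on RP2.

Definition rp2_proj (x : S2) : RP2 := \pi_RP2 x.

(* The absolute value makes the choice of representatives irrelevant. *)
Definition rp2_dist (p q : RP2) : R :=
  acos `|dotp (val (repr p)) (val (repr q))|.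

Definition rp2_isometry (phi : RP2 -> RP2) : Prop :=
  forall p q, rp2_dist (phi p) (phi q) = rp2_dist p q.

End ProjectivePlane.

Notation borelRP2 R := (g_sigma_algebraType (@open (RP2 R))).

Section GreenFunction.
Variable R : realType.
Local Notation S2 := (S2 R).
Local Notation RP2 := (RP2 R).

Definition isometry_invariant (sigma : probability (borelRP2 R) R) : Prop :=
  forall phi : RP2 -> RP2, rp2_isometry phi ->
  forall A : set (borelRP2 R), measurable A -> sigma (phi @^-1` A) = sigma A.

Definition partial_deriv (i : 'I_2) (W : normedModType R) (h : 'rV[R]_2 -> W)
  : 'rV[R]_2 -> W := 'D_(delta_mx 0 i) h.

(* First fundamental form g_ij of psi : R^2 -> S^2. *)
Definition metric_tensor (psi : 'rV[R]_2 -> S2) (u : 'rV[R]_2) : 'M[R]_2 :=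
  \matrix_(i, j) dotp (partial_deriv i (fun v => val (psi v)) u)
                      (partial_deriv j (fun v => val (psi v)) u).

(* Composed with rp2_proj, which is a local isometry, these are exactly the local
   parametrizations of RP^2. *)
Definition local_param (U : set 'rV[R]_2) (psi : 'rV[R]_2 -> S2) : Prop :=
  [/\ open U,
      smooth_on U (fun u => val (psi u)) &
      forall u, U u -> 0 < \det (metric_tensor psi u)].

Definition smooth_RP2 (f : RP2 -> R) : Prop :=
  forall U psi, local_param U psi -> smooth_on U (fun u => f (rp2_proj (psi u))).

(* - |g|^(-1/2) sum_i d_i (|g|^(1/2) sum_j g^ij d_j h) *)
Definition chart_laplacian (psi : 'rV[R]_2 -> S2) (h : 'rV[R]_2 -> R)
    (u : 'rV[R]_2) : R :=
  - (Num.sqrt (\det (metric_tensor psi u)))^-1 *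
    \sum_(i < 2) partial_deriv i (fun v =>
      Num.sqrt (\det (metric_tensor psi v)) *
      \sum_(j < 2) (invmx (metric_tensor psi v)) i j * partial_deriv j h v) u.

(* The Laplace-Beltrami equation "Laplacian of g = f", in every local
   parametrization. *)
Definition laplace_beltrami_eq (g f : RP2 -> R) : Prop :=
  forall U psi, local_param U psi -> forall u, U u ->
  chart_laplacian psi (fun v => g (rp2_proj (psi v))) u = f (rp2_proj (psi u)).

Definition potential (sigma : probability (borelRP2 R) R) (G : RP2 -> RP2 -> R)
    (f : RP2 -> R) : RP2 -> R :=
  fun x => \int[sigma]_y (G x y * f y).

(* The integral identities determine G x only almost everywhere; continuity
   off the diagonal singles out the pointwise kernel. The diagonal values,
   +oo for the genuine kernel, are left arbitrary. *)
Definition is_green_function (sigma : probability (borelRP2 R) R)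
    (G : RP2 -> RP2 -> R) : Prop :=
  [/\ forall x y : RP2, x != y ->
        {for (x, y), continuous (fun z : RP2 * RP2 => G z.1 z.2)},
      forall x : RP2, sigma.-integrable setT (fun y => (G x y)%:E),
      forall x : RP2, \int[sigma]_y G x y = 0 &
      forall f : RP2 -> R, smooth_RP2 f -> \int[sigma]_y f y = 0 ->
        [/\ smooth_RP2 (potential sigma G f),
            laplace_beltrami_eq (potential sigma G f) f &
            \int[sigma]_x potential sigma G f x = 0]].

Definition green_energy (G : RP2 -> RP2 -> R) (N : nat) (omega : 'I_N -> RP2)
  : R := \sum_(i < N) \sum_(j < N | j != i) G (omega i) (omega j).

End GreenFunction.

(* Main.v *)
Require Import Defs.
From mathcomp Require Import all_boot all_order all_algebra.
From mathcomp Require Import ring lra.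
From mathcomp Require Import all_classical all_reals all_analysis.
From mathcomp Require Import measurable_realfun.

(** Write q(x,y) = <x,y>^2, which is well defined on the projective plane. The
    Green function is the sum of the series

      G(x,y) = sum_(k >= 1) (q(x,y)^k - 1/(2k+1)) / (2k),

    that is, log 2 - 1 - log(1 - q(x,y)) / 2. Let G_N be the sum of its N first
    terms. The energy bound comes from comparing G with G_N, N being the number
    of points, and rests on three facts.

    - Off the diagonal G >= G_N - 1/(4N): the terms q^k/(2k) that are left out
      are nonnegative, and the constants that are left out sum up to less than
      1/(4N) ([green_trunc_le_green]).
    - The sum of G_N(x_i,x_j) over all pairs (i,j), i = j included, is
      nonnegative. For each power this is Welch's inequality, the sum of
      q(x_i,x_j)^k being at least N^2/(2k+1) ([sum_cos2_pow_ge]).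
    - G_N(x,x) is at most half the harmonic number H_N, hence at most
      (1 + log N)/2 ([green_trunc1_le]).

    Summing the first inequality over i <> j and subtracting the diagonal from
    the second one gives an energy of at least - N (1 + log N)/2 - N/4.

    Both the expansion of G and the moments 1/(2k+1) are extracted from the
    defining property of a Green function. On the unit sphere the Laplacian of
    q(.,r)^k/(2k) is (2k+1) q^k - (2k-1) q^(k-1), so that G_n(.,r) has Laplacian
    (2n+1) q(.,r)^n - 1 ([laplacian_green_trunc]). Let c be the mean of
    (2n+1) q(.,r)^n. The potential of (2n+1) q(.,r)^n - c differs from G_n(.,r)
    by a smooth function whose Laplacian is the constant 1 - c. By the maximum
    principle c = 1 and the difference is constant ([constant_laplacian]), hence
    zero since both functions have mean zero. Therefore the integral of
    (2n+1) G(x,.) q(.,r)^n is G_n(x,r) ([green_potential_power]). As n grows,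
    the weights (2n+1) q(.,r)^n concentrate at r, and for x <> r the continuity
    of G(x,.) at r makes these integrals tend to G(x,r); only the upper bound
    on their limit is used ([green_trunc_le_green_eventually]).

    The Laplace-Beltrami equation is used in one chart only, the stereographic
    one: it is onto the projective plane, already from a compact square, and it
    is conformal, so that it turns the equation into a Poisson equation in the
    plane. *)

Set Implicit Arguments.
Unset Strict Implicit.
Unset Printing Implicit Defensive.

Import Order.TTheory GRing.Theory Num.Theory.
Import numFieldNormedType.Exports.

Local Open Scope classical_set_scope.
Local Open Scope ring_scope.

(** * Calculus of smooth functions *)

Section SmoothCalculus.
Context {R : realType} {V : normedModType R}.
Implicit Types U : set V.

Lemma iter_derive_rcons (W : normedModType R) (vs : seq V) v (f : V -> W) :
  iter_derive (rcons vs v) f = iter_derive vs ('D_v f).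
Proof. by elim: vs => //= w vs ->. Qed.

Lemma eq_on_derive (W : normedModType R) U (f g : V -> W) v :
  open U -> (forall x, U x -> f x = g x) ->
  forall x, U x -> 'D_v f x = 'D_v g x.
Proof.
move=> oU fg x Ux; apply: near_eq_derive.
by apply: filterS (open_nbhs_nbhs (conj oU Ux)) => y /fg.
Qed.

Lemma eq_on_differentiable (W : normedModType R) U (f g : V -> W) :
  open U -> (forall x, U x -> f x = g x) ->
  forall x, U x -> differentiable f x -> differentiable g x.
Proof.
move=> oU fg x Ux df.
have fgn : \forall y \near x, f y = g y.
  by apply: filterS (open_nbhs_nbhs (conj oU Ux)) => y /fg.
have cdf : continuous ('d f x) by exact: diff_continuous.
have dg : g \o shift x = cst (g x) + 'd f x +o_ 0 id.
  apply/eqaddoP => e e0; have /eqaddoP /(_ e e0) := diff_locally df.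
  have : \forall h \near (0 : V), f (h + x) = g (h + x).
    move: fgn; rewrite (near_shift 0) /=; apply: filterS => h /=.
    by rewrite subr0.
  by apply: filterS2 => h /= fgh; rewrite !fctE /= fgh fg.
by apply/diff_locallyP; rewrite (diff_unique cdf dg).
Qed.

Lemma eq_on_iter_derive (W : normedModType R) U (f g : V -> W) vs :
  open U -> (forall x, U x -> f x = g x) ->
  forall x, U x -> iter_derive vs f x = iter_derive vs g x.
Proof. by move=> oU fg; elim: vs => //= v vs IH; exact: eq_on_derive. Qed.

Lemma smooth_on_differentiable (W : normedModType R) U (f : V -> W) x :
  smooth_on U f -> U x -> differentiable f x.
Proof. by move=> sf; exact: (sf [::]). Qed.

Lemma smooth_on_derive (W : normedModType R) U (f : V -> W) v :
  smooth_on U f -> smooth_on U ('D_v f).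
Proof. by move=> sf vs x Ux; rewrite -iter_derive_rcons; exact: sf. Qed.

(** Smoothness by coinduction: a class of functions differentiable on U whose
    directional derivatives stay in the class, up to equality on U, contains
    only smooth functions. *)
Lemma smooth_on_coind (W : normedModType R) U (P : (V -> W) -> Prop) :
  open U ->
  (forall f x, P f -> U x -> differentiable f x) ->
  (forall f v, P f -> exists2 g, P g & forall x, U x -> 'D_v f x = g x) ->
  forall f, P f -> smooth_on U f.
Proof.
move=> oU Pdiff Pder f Pf vs.
elim/last_ind: vs f Pf => [|vs v IH] f Pf x Ux; first exact: Pdiff Pf Ux.
rewrite iter_derive_rcons; have [g Pg fg] := Pder f v Pf.
apply: (eq_on_differentiable oU _ Ux (IH g Pg x Ux)) => y Uy.
by rewrite (eq_on_iter_derive vs oU fg Uy).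
Qed.

(** Sums, products and inverses are treated together, because the derivative
    of each of these operations involves the other ones. *)
Inductive smooth_expr U : (V -> R) -> Prop :=
| SmoothBase f of smooth_on U f : smooth_expr U f
| SmoothAdd f g of smooth_expr U f & smooth_expr U g : smooth_expr U (f + g)
| SmoothMul f g of smooth_expr U f & smooth_expr U g : smooth_expr U (f * g)
| SmoothInv f of smooth_expr U f & (forall x, U x -> f x != 0) :
    smooth_expr U (fun x => (f x)^-1).

Lemma smooth_on_cst (W : normedModType R) U (c : W) :
  open U -> smooth_on U (cst c : V -> W).
Proof.
move=> oU; apply: (smooth_on_coind (P := fun f => exists c, f = cst c)) => //.
- by move=> _ x [{}c ->] _; exact: differentiable_cst.
- move=> _ v [{}c ->]; exists (cst 0); first by exists 0.
  by move=> x _; rewrite derive_cst.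
- by exists c.
Qed.

Lemma smooth_expr_differentiable U (f : V -> R) x :
  smooth_expr U f -> U x -> differentiable f x.
Proof.
move=> + Ux; elim => {f}[f sf|f g _ df _ dg|f g _ df _ dg|f _ df f0].
- exact: smooth_on_differentiable sf Ux.
- exact: differentiableD.
- exact: differentiableM.
- by apply: differentiableV => //; exact: f0.
Qed.

Lemma smooth_expr_smooth U (f : V -> R) :
  open U -> smooth_expr U f -> smooth_on U f.
Proof.
move=> oU; apply: smooth_on_coind => //.
  by move=> {}f x; exact: smooth_expr_differentiable.
have sder h x v : smooth_expr U h -> U x -> derivable h x v.
  by move=> sh Ux; exact/diff_derivable/(smooth_expr_differentiable sh).
move=> {}f v; elim => {f}
  [f sf|f g sf [f' sf' ff'] sg [g' sg' gg']|
   f g sf [f' sf' ff'] sg [g' sg' gg']|f sf [f' sf' ff'] f0].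
- by exists ('D_v f) => //; exact/SmoothBase/smooth_on_derive.
- exists (f' + g'); first exact: SmoothAdd.
  by move=> x Ux; rewrite deriveD ?ff' ?gg' //; exact: sder.
- exists (f * g' + g * f'); first by apply: SmoothAdd; exact: SmoothMul.
  by move=> x Ux; rewrite deriveM ?ff' ?gg' //; exact: sder.
- exists (cst (-1) * ((fun x => (f x)^-1) * (fun x => (f x)^-1)) * f').
    apply: SmoothMul => //; apply: SmoothMul.
      exact/SmoothBase/smooth_on_cst.
    by apply: SmoothMul; exact: SmoothInv.
  move=> x Ux; rewrite deriveV ?ff' //; [|exact: f0|exact: sder].
  by rewrite !fctE mulN1r -expr2 exprVn.
Qed.

Lemma smooth_onD U (f g : V -> R) : open U ->
  smooth_on U f -> smooth_on U g -> smooth_on U (fun x => f x + g x).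
Proof.
by move=> oU sf sg; apply/(smooth_expr_smooth oU)/SmoothAdd; exact: SmoothBase.
Qed.

Lemma smooth_onM U (f g : V -> R) : open U ->
  smooth_on U f -> smooth_on U g -> smooth_on U (fun x => f x * g x).
Proof.
by move=> oU sf sg; apply/(smooth_expr_smooth oU)/SmoothMul; exact: SmoothBase.
Qed.

Lemma smooth_onV U (f : V -> R) : open U -> (forall x, U x -> f x != 0) ->
  smooth_on U f -> smooth_on U (fun x => (f x)^-1).
Proof.
move=> oU f0 sf; apply/(smooth_expr_smooth oU)/SmoothInv => //.
exact: SmoothBase.
Qed.

Lemma smooth_onB U (f g : V -> R) : open U ->
  smooth_on U f -> smooth_on U g -> smooth_on U (fun x => f x - g x).
Proof.
move=> oU sf sg; apply: smooth_onD => //.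
rewrite (_ : (fun x => - g x) = fun x => cst (-1) x * g x).
  by apply: smooth_onM => //; exact: smooth_on_cst.
by apply/funext => x; rewrite mulN1r.
Qed.

Lemma smooth_onX U (f : V -> R) n : open U ->
  smooth_on U f -> smooth_on U (fun x => f x ^+ n).
Proof.
move=> oU sf; elim: n => [|n IH].
  by rewrite (_ : (fun x => _) = cst 1) //; exact: smooth_on_cst.
rewrite (_ : (fun x => _) = fun x => f x * f x ^+ n); first exact: smooth_onM.
by apply/funext => x; rewrite exprS.
Qed.

Lemma smooth_on_sum (I : Type) (r : seq I) (P : pred I) U (f : I -> V -> R) :
  open U -> (forall i, smooth_on U (f i)) ->
  smooth_on U (fun x => \sum_(i <- r | P i) f i x).
Proof.
move=> oU sf; elim: r => [|i r IH].
  rewrite (_ : (fun x => _) = cst 0); first exact: smooth_on_cst.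
  by apply/funext => x; rewrite big_nil.
rewrite (_ : (fun x => _) =
    fun x => (if P i then f i x else 0) + \sum_(j <- r | P j) f j x).
  by apply: smooth_onD => //; case: (P i) => //; exact: smooth_on_cst.
by apply/funext => x; rewrite big_cons; case: (P i) => //; rewrite add0r.
Qed.

Lemma differentiable_rV n (f : V -> 'rV[R]_n) x :
  (forall i, differentiable (fun y => f y 0 i) x) -> differentiable f x.
Proof.
move=> df; rewrite (_ : f = \sum_(i < n) (fun y => f y 0 i *: delta_mx 0 i)).
  by apply: differentiable_sum => i; exact: differentiableZl.
by apply/funext => y; rewrite fct_sumE -row_sum_delta.
Qed.

Lemma smooth_on_rV n U (f : V -> 'rV[R]_n) : open U ->
  smooth_on U f <-> forall i, smooth_on U (fun y => f y 0 i).
Proof.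
move=> oU; split=> [sf i|].
  pose P (g : V -> R) :=
    exists2 f : V -> 'rV[R]_n, smooth_on U f & g = (fun y => f y 0 i).
  apply: (smooth_on_coind (P := P)) => //; last by exists f.
  - move=> _ x [{sf}f sf ->] Ux.
    apply: (differentiable_comp (g := fun N : 'rV[R]_n => N 0 i)).
      exact: smooth_on_differentiable sf Ux.
    exact: differentiable_coord.
  - move=> _ v [{sf}f sf ->]; exists (fun y => 'D_v f y 0 i).
      by exists ('D_v f) => //; exact: smooth_on_derive.
    move=> x Ux; rewrite derive_mx ?mxE //.
    exact/diff_derivable/(smooth_on_differentiable sf).
apply: (smooth_on_coind
  (P := fun f : V -> 'rV_n => forall i, smooth_on U (fun y => f y 0 i))) => //.
- move=> {}f x sf Ux; apply: differentiable_rV => i.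
  exact: smooth_on_differentiable (sf i) Ux.
- move=> {}f v sf.
  exists (fun x => \row_i 'D_v (fun y => f y 0 i) x).
    move=> i; rewrite (_ : (fun y => _) = 'D_v (fun y => f y 0 i)).
      exact: smooth_on_derive.
    by apply/funext => y; rewrite mxE.
  move=> x Ux; rewrite derive_mx.
    by apply/matrixP => i j; rewrite !mxE ord1.
  apply/diff_derivable/differentiable_rV => i.
  exact: smooth_on_differentiable (sf i) Ux.
Qed.

End SmoothCalculus.

Lemma smooth_on_coord {R : realType} n (U : set 'rV[R]_n) i :
  open U -> smooth_on U (fun u : 'rV[R]_n => u 0 i).
Proof.
move=> oU; pose P (f : 'rV[R]_n -> R) := f = (fun u => u 0 i) \/ smooth_on U f.
apply: (smooth_on_coind (P := P)) => //; last by left.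
- move=> f x [->|sf] Ux; first exact: differentiable_coord.
  exact: smooth_on_differentiable sf Ux.
- move=> f v [->|sf].
    exists (cst (v 0 i)); first by right; exact: smooth_on_cst.
    move=> x Ux; have dx : derivable (@id 'rV[R]_n) x v by [].
    have := derive_mx dx.
    by rewrite derive_id => /matrixP /(_ 0 i); rewrite mxE => <-.
  by exists ('D_v f) => //; right; exact: smooth_on_derive.
Qed.

(** * The Laplacian of the plane *)

Section SecondDerivativeTest.
Context {R : realType} {V : normedModType R}.

Lemma is_derive_line (f : V -> R) y e s :
  derivable f (s *: e + y) e ->
  is_derive s 1 (fun t : R => f (t *: e + y)) ('D_e f (s *: e + y)).
Proof.
rewrite /derivable => df.
have E : (fun h : R => h^-1 *: (((fun t : R => f (t *: e + y)) \o shift s)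
             (h *: (1 : R)) - f (s *: e + y))) =
         (fun h : R => h^-1 *: ((f \o shift (s *: e + y)) (h *: e)
             - f (s *: e + y))).
  by apply/funext => h /=; rewrite [h *: 1]mulr1 scalerDl addrA.
by apply: DeriveDef; rewrite /derivable /derive E.
Qed.

(** If the second derivative along e were positive at y, the first derivative,
    which vanishes at y, would be positive just after y, and f would increase
    along the ray. *)
Lemma derive2_at_max (U : set V) (f : V -> R) y e :
  open U -> U y -> smooth_on U f -> (forall z, U z -> f z <= f y) ->
  'D_e ('D_e f) y <= 0.
Proof.
move=> oU Uy sf fmax; rewrite leNgt; apply/negP => c0.
pose l (t : R) := t *: e + y.
have l0 : l 0 = y by rewrite /l scale0r add0r.
have lc : continuous l.
  move=> t; apply: cvgD; last exact: cvg_cst.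
  exact: scalel_continuous.
have [r /= r0 rU] : \forall t \near (0 : R), U (l t).
  have := lc 0; rewrite /continuous_at l0 => /(_ U); apply.
  exact: open_nbhs_nbhs.
have {}rU t : `|t| < r -> U (l t).
  by move=> tr; apply: rU; rewrite /ball_ /= sub0r normrN.
pose g (t : R) : R := f (l t); pose g' (t : R) : R := 'D_e f (l t).
have dg (t : R) : `|t| < r -> is_derive t 1 g (g' t).
  move=> tr; apply: is_derive_line; apply: diff_derivable.
  exact: smooth_on_differentiable sf (rU _ tr).
have g'0 : g' 0 = 0.
  have tr t : t \in `]- r, r[%R -> `|t| < r by rewrite in_itv /= ltr_norml.
  have : is_derive (0 : R) 1 g 0.
    apply: (@derive1_at_max _ g (- r) r) => [|t /tr /dg []//||t /tr/rU].
    - by rewrite ge0_cp // ltW.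
    - by rewrite in_itv /= oppr_lt0 r0.
    - by move=> /fmax; rewrite /g l0.
  have /dg : `|0 : R| < r by rewrite normr0.
  by move=> [_ <-] [_].
have dg' : is_derive (0 : R) 1 g' ('D_e ('D_e f) y).
  rewrite -l0; apply: is_derive_line; apply: diff_derivable.
  rewrite -/(l 0) l0; apply: smooth_on_differentiable Uy.
  exact: smooth_on_derive.
move: dg' => [dg' dg'E].
have g'E : (fun h : R => h^-1 *: ((g' \o shift 0) (h *: 1) - g' 0)) =
           (fun h : R => h^-1 *: (g' h - g' 0)).
  by apply/funext => h /=; rewrite [h *: 1]mulr1 addr0.
have : h^-1 *: (g' h - g' 0) @[h --> 0^'] --> 'D_e ('D_e f) y.
  by rewrite -dg'E /derive -g'E; exact: dg'.
move=> /cvgr_gt /(_ _ c0) [d /= d0 dpos].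
have cont_g t : `|t| < r -> {for t, continuous g}.
  by move=> /dg [] /derivable1_diffP /differentiable_continuous.
have gmax t : `|t| < r -> g t <= g 0 by move=> /rU/fmax; rewrite /g l0.
move: g' g'0 dpos dg {g'E dg' dg'E c0} => g' g'0 dpos dg.
have g'pos t : 0 < t -> t < d -> 0 < g' t.
  move=> t0 td; have := dpos t; rewrite /ball_ /= sub0r normrN gtr0_norm //.
  move=> /(_ td (lt0r_neq0 t0)); rewrite g'0 subr0 [_ *: _]mulrC.
  by rewrite pmulr_lgt0 // invr_gt0.
pose t := Num.min r d / 2.
have m0 : 0 < Num.min r d by rewrite lt_min r0 d0.
have t0 : 0 < t by rewrite divr_gt0.
have tm : t < Num.min r d by rewrite /t; lra.
have [tr td] : t < r /\ t < d by move: tm; rewrite lt_min => /andP.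
have dgt s : s \in `]0, t[%R -> is_derive s 1 g (g' s).
  rewrite in_itv /= => /andP[s0 st]; apply: dg.
  by rewrite gtr0_norm // (lt_trans st).
have cg : {within `[0, t], continuous g}.
  apply: continuous_in_subspaceT => s; rewrite inE /= in_itv /= => /andP[s0 st].
  by apply: cont_g; rewrite ger0_norm // (le_lt_trans st).
have [s] := MVT t0 dgt cg.
rewrite in_itv /= => /andP[s0 st] gE.
have : 0 < g t - g 0.
  by rewrite gE subr0 mulr_gt0 // g'pos // (lt_trans st).
by rewrite subr_gt0 ltNge gmax // gtr0_norm.
Qed.

End SecondDerivativeTest.

Section PointwiseDerivationRules.
Context {R : realType} {V : normedModType R}.
Implicit Types f g : V -> R.

Lemma is_derive_addf f g x v df dg : is_derive x v f df -> is_derive x v g dg ->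
  is_derive x v (fun u => f u + g u) (df + dg).
Proof. exact: is_deriveD. Qed.

Lemma is_derive_oppf f x v df : is_derive x v f df ->
  is_derive x v (fun u => - f u) (- df).
Proof. exact: is_deriveN. Qed.

Lemma is_derive_mulf f g x v df dg : is_derive x v f df -> is_derive x v g dg ->
  is_derive x v (fun u => f u * g u) (f x * dg + g x * df).
Proof. exact: is_deriveM. Qed.

Lemma is_derive_invf f x v df : f x != 0 -> is_derive x v f df ->
  is_derive x v (fun u => (f u)^-1) (- (f x) ^- 2 * df).
Proof.
move=> f0 [d <-]; apply: DeriveDef; first exact: derivableV.
by rewrite deriveV.
Qed.

Lemma is_derive_expf f n x v df : is_derive x v f df ->
  is_derive x v (fun u => f u ^+ n) (n%:R * f x ^+ n.-1 * df).
Proof.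
move=> fd; rewrite (_ : (fun u => _) = f ^+ n); first exact: is_deriveX.
by apply/funext => u; rewrite exprfctE.
Qed.

End PointwiseDerivationRules.

Lemma is_derive_coord {R : realType} n (x v : 'rV[R]_n) i :
  is_derive x v (fun u : 'rV[R]_n => u 0 i) (v 0 i).
Proof.
apply: DeriveDef; first exact/diff_derivable/differentiable_coord.
have dx : derivable (@id 'rV[R]_n) x v by [].
by have := derive_mx dx; rewrite derive_id => /matrixP /(_ 0 i); rewrite mxE.
Qed.

(** Differentiates a pointwise expression in the coordinates; the derivatives of
    other functions and the nonvanishing of denominators are left as goals. *)
Ltac der :=
  lazymatch goal with
  | |- is_derive _ _ (fun _ => ?c) _ => exact: is_derive_cst
  | |- is_derive _ _ (fun u => @?f u + @?g u) _ =>
      apply: (@is_derive_addf _ _ f g); der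
  | |- is_derive _ _ (fun u => - @?f u) _ => apply: (@is_derive_oppf _ _ f); der
  | |- is_derive _ _ (fun u => @?f u * @?g u) _ =>
      apply: (@is_derive_mulf _ _ f g); der
  | |- is_derive _ _ (fun u => (@?f u)^-1) _ =>
      apply: (@is_derive_invf _ _ f); der
  | |- is_derive _ _ (fun u => (@?f u) ^+ ?n) _ =>
      apply: (@is_derive_expf _ _ f n); der
  | |- is_derive _ _ (fun u => fun_of_matrix u _ _) _ => exact: is_derive_coord
  | |- _ => idtac
  end.

Lemma ord2P (i : 'I_2) : i = 0 \/ i = 1.
Proof. by case: i => [[|[|//]] ?]; [left|right]; apply: val_inj. Qed.

Section PlaneLaplacian.
Context {R : realType}.
Implicit Types (U : set 'rV[R]_2) (h : 'rV[R]_2 -> R) (u a : 'rV[R]_2).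

Definition laplacian h u : R :=
  \sum_(i < 2) partial_deriv i (partial_deriv i h) u.

Lemma laplacianE h u : laplacian h u =
  partial_deriv 0 (partial_deriv 0 h) u + partial_deriv 1 (partial_deriv 1 h) u.
Proof.
rewrite /laplacian big_ord_recl big_ord1.
by rewrite (_ : lift ord0 ord0 = 1) //; exact: val_inj.
Qed.

Lemma laplacianD U h k u : open U -> U u -> smooth_on U h -> smooth_on U k ->
  laplacian (fun v => h v + k v) u = laplacian h u + laplacian k u.
Proof.
move=> oU Uu sh sk; rewrite -big_split /=; apply: eq_bigr => i _.
have der (f : 'rV[R]_2 -> R) v :
    smooth_on U f -> U v -> derivable f v (delta_mx 0 i).
  by move=> sf Uv; apply: diff_derivable; exact: smooth_on_differentiable sf Uv.
have Uder (f : 'rV[R]_2 -> R) :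
    smooth_on U f -> derivable (partial_deriv i f) u (delta_mx 0 i).
  by move=> sf; apply: der => //; exact: smooth_on_derive.
apply: etrans (deriveD (Uder _ sh) (Uder _ sk)).
apply: (eq_on_derive _ oU _ Uu) => v Uv.
by apply: deriveD; exact: der.
Qed.

Lemma laplacianZ U h c u : open U -> U u -> smooth_on U h ->
  laplacian (fun v => c * h v) u = c * laplacian h u.
Proof.
move=> oU Uu sh; rewrite mulr_sumr; apply: eq_bigr => i _.
have der (f : 'rV[R]_2 -> R) v :
    smooth_on U f -> U v -> derivable f v (delta_mx 0 i).
  by move=> sf Uv; apply: diff_derivable; exact: smooth_on_differentiable sf Uv.
have Uder (f : 'rV[R]_2 -> R) :
    smooth_on U f -> derivable (partial_deriv i f) u (delta_mx 0 i).
  by move=> sf; apply: der => //; exact: smooth_on_derive.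
apply: etrans (deriveZ c (Uder _ sh)).
apply: (eq_on_derive _ oU _ Uu) => v Uv.
by apply: deriveZ; exact: der.
Qed.

Lemma laplacian_at_max U h y : open U -> U y -> smooth_on U h ->
  (forall u, U u -> h u <= h y) -> laplacian h y <= 0.
Proof.
move=> oU Uy sh hmax; apply: sumr_le0 => i _; exact: derive2_at_max hmax.
Qed.

Definition sqdist a u : R := (u 0 0 - a 0 0) ^+ 2 + (u 0 1 - a 0 1) ^+ 2.

Lemma smooth_sqdist U a : open U -> smooth_on U (sqdist a).
Proof.
move=> oU; apply: smooth_onD => //; apply: smooth_onX => //;
  apply: smooth_onB => //; [exact: smooth_on_coord|exact: smooth_on_cst|
  exact: smooth_on_coord|exact: smooth_on_cst].
Qed.

Lemma continuous_sqdist a : continuous (sqdist a).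
Proof.
move=> v; apply: differentiable_continuous.
exact: (smooth_sqdist a openT [::]).
Qed.

Lemma laplacian_invr_sqdist a u : 0 < sqdist a u ->
  laplacian (fun v => (sqdist a v)^-1) u = 4 * (sqdist a u) ^- 2.
Proof.
pose U := [set v | 0 < sqdist a v].
have oU : open U.
  apply: (open_comp (f := sqdist a) (D := [set x | 0 < x])).
    by move=> v _; exact: continuous_sqdist.
  exact: open_gt.
move=> u0.
have d1 (i : 'I_2) v : U v -> partial_deriv i (fun v => (sqdist a v)^-1) v =
    - 2 * (v 0 i - a 0 i) * (sqdist a v) ^- 2.
  move=> Uv; apply: derive_val; rewrite /sqdist; apply: is_derive_eq.
    der; exact: lt0r_neq0.
  rewrite !mxE /=; have v0 := lt0r_neq0 Uv.
  by case: (ord2P i) => ->; rewrite /= ?mulr0n ?mulr1n ?expr1; field.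
have d2 (i : 'I_2) : partial_deriv i (partial_deriv i
      (fun v => (sqdist a v)^-1)) u =
    - 2 * (sqdist a u) ^- 2 + 8 * (u 0 i - a 0 i) ^+ 2 * (sqdist a u) ^- 3.
  rewrite [LHS](eq_on_derive _ oU (d1 i) u0).
  have u00 := lt0r_neq0 u0.
  apply: derive_val; rewrite /sqdist; apply: is_derive_eq.
    by der; rewrite expf_neq0.
  rewrite !mxE /=.
  case: (ord2P i) => ->; rewrite /= ?mulr0n ?mulr1n ?expr1; field; exact: u00.
rewrite laplacianE !d2; have u00 := lt0r_neq0 u0.
move: u00; rewrite /sqdist => u00; field; exact: u00.
Qed.

End PlaneLaplacian.

(** * The strong maximum principle in the plane *)

Section StrongMaximumPrinciple.
Context {R : realType}.
Implicit Types u a : 'rV[R]_2.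

Lemma coord_sub_sq_le_sqdist a u (i : 'I_2) : (u 0 i - a 0 i) ^+ 2 <= sqdist a u.
Proof.
by case: (ord2P i) => ->; rewrite /sqdist ?lerDl ?lerDr sqr_ge0.
Qed.

Lemma sqdist_lt_ball a u r : 0 < r -> sqdist a u < r ^+ 2 -> ball a r u.
Proof.
move=> r0 ar; split => // i j; rewrite (ord1 i) /ball /=.
rewrite -(@ltr_pXn2r _ 2) ?nnegrE ?(ltW r0) // real_normK ?num_real //.
by rewrite -sqrrN opprB; apply: le_lt_trans ar; exact: coord_sub_sq_le_sqdist.
Qed.

Lemma compact_annulus a r s : compact [set u | r <= sqdist a u <= s].
Proof.
apply: bounded_closed_compact; last first.
  rewrite (_ : [set u | _] = sqdist a @^-1` `[r, s]); last first.
    by apply/seteqP; split => u /=; rewrite in_itv.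
  apply: preimage_closed; first by move=> u _; exact: continuous_sqdist.
  exact: itv_closed.
exists (`|a| + (`|s| + 1)); split; first exact: num_real.
move=> M aM u /= /andP[_ us]; apply: le_trans (ltW aM).
rewrite -[u](subrK a) addrC; apply: le_trans (ler_normD _ _) _.
rewrite lerD2l [leLHS]/Num.Def.normr /= mx_normrE.
apply: bigmax_le; first by rewrite addr_ge0.
move=> [i j] _ /=; rewrite !mxE (ord1 i).
have /le_trans /(_ us) H := coord_sub_sq_le_sqdist a u j.
set t := _ + _; have -> : t = u 0 j - a 0 j by [].
have [|t1] := lerP `|u 0 j - a 0 j| 1; first by move/le_trans; apply; rewrite lerDr.
rewrite (le_trans (y := `|s|)) ?lerDl //; apply: le_trans _ (ler_norm _).
apply: le_trans _ H; rewrite -[leRHS]real_normK ?num_real // expr2.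
by rewrite ler_peMl // ltW.
Qed.

(** Suppose that w is smaller than its maximum at some point a, hence on a disc
    around a. Add to w a small multiple of the strictly subharmonic function
    1/|u - a|^2. The sum exceeds the maximum of w at u0, but neither on the
    boundary of the disc, where the multiple is too small to matter, nor, up to
    its value at u0, far away, where it has decayed. It therefore has an
    interior maximum outside the disc, although its Laplacian is positive
    there. *)
Lemma harmonic_at_max_cst (w : 'rV[R]_2 -> R) u0 :
  smooth_on setT w -> (forall u, laplacian w u = 0) ->
  (forall u, w u <= w u0) -> forall a, w a = w u0.
Proof.
move=> sw hw wmax a; apply/eqP; rewrite eq_le wmax /= leNgt; apply/negP => wa.
pose d := (w u0 - w a) / 2.
have d0 : 0 < d by rewrite divr_gt0 // subr_gt0.
have cw : continuous w.
  by move=> u; apply: differentiable_continuous; exact: (sw [::]).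
have /nbhs_ballP [r /= r0 rw] : \forall u \near a, w u < w u0 - d.
  have := cw a; move=> /cvgr_lt /(_ (w u0 - d)); apply; rewrite /d; lra.
pose r1 := r / 2; have r10 : 0 < r1 by rewrite divr_gt0.
have {}rw u : sqdist a u <= r1 ^+ 2 -> w u < w u0 - d.
  move=> ur; apply/rw/sqdist_lt_ball => //; apply: le_lt_trans ur _.
  by rewrite ltr_pXn2r ?nnegrE ?ltW // /r1; lra.
have r12 : 0 < r1 ^+ 2 by rewrite exprn_gt0.
have u0r : r1 ^+ 2 < sqdist a u0.
  by rewrite ltNge; apply/negP => /rw; rewrite ltNge lerBlDr lerDl ltW.
have q0 : 0 < sqdist a u0 by exact: lt_trans u0r.
(* Any bound larger than the squared distance from a to u0 would do. *)
pose P := sqdist a u0 + 1.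
pose e := d * r1 ^+ 2.
have e0 : 0 < e by rewrite mulr_gt0.
(* The disc has radius r1, on whose boundary e / r1^2 = d. *)
pose v u := w u + e * (sqdist a u)^-1.
pose O := [set u | r1 ^+ 2 < sqdist a u < P].
have oO : open O.
  rewrite (_ : O = sqdist a @^-1` `]r1 ^+ 2, P[); last first.
    by apply/seteqP; split => u /=; rewrite in_itv.
  apply: open_comp; first by move=> u _; exact: continuous_sqdist.
  exact: itv_open.
have pos u : r1 ^+ 2 <= sqdist a u -> 0 < sqdist a u by exact: lt_le_trans.
have sB : smooth_on O (fun u => (sqdist a u)^-1).
  apply: smooth_onV (smooth_sqdist a oO) => // u /andP[/ltW /pos u_gt0 _].
  exact: lt0r_neq0.
have swO : smooth_on O w by move=> vs x _; exact: sw.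
have seB : smooth_on O (fun u => e * (sqdist a u)^-1).
  by apply: smooth_onM => //; exact: smooth_on_cst.
have sv : smooth_on O v by exact: smooth_onD.
have cv : {within [set u | r1 ^+ 2 <= sqdist a u <= P], continuous v}.
  apply: continuous_in_subspaceT => u; rewrite inE /= => /andP[ur _].
  apply: differentiable_continuous; apply: differentiableD.
    exact: (sw [::]).
  apply: differentiableM; first exact: differentiable_cst.
  apply: differentiableV; last exact/lt0r_neq0/pos.
  exact: (smooth_sqdist a openT [::]).
have u0K : [set u | r1 ^+ 2 <= sqdist a u <= P] u0.
  by rewrite /= (ltW u0r) /= /P lerDl.
have [|y yK vmax] := @EVT_max_rV _ _ v _ _ (@compact_annulus a (r1 ^+ 2) P) cv.
  by exists u0.
have {}vmax u : r1 ^+ 2 <= sqdist a u <= P -> v u <= v y.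
  by move=> uK; apply: vmax; rewrite inE.
have vu0 := vmax _ u0K.
move: yK; rewrite inE /= => /andP[]; rewrite le_eqVlt => /predU1P[yr _|yr].
  have /rw : sqdist a y <= r1 ^+ 2 by rewrite yr.
  apply/negP; rewrite -leNgt -(lerD2r (e * (sqdist a y)^-1)) -/(v y).
  apply: le_trans vu0; rewrite -yr /e mulfK ?lt0r_neq0 // subrK.
  by rewrite lerDl mulr_ge0 ?invr_ge0 // ltW.
rewrite le_eqVlt => /predU1P[yP|yP].
  move: vu0; apply/negP; rewrite -ltNge; apply: le_lt_trans (_ : w u0 + e / P < _).
    by rewrite /v yP lerD2r.
  have P0 : 0 < P by rewrite addr_gt0.
  by rewrite /v ltrD2l ltr_pM2l // ltf_pV2 ?posrE // ltrDl.
have Oy : O y by rewrite /O /= yr.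
have : laplacian v y <= 0.
  apply: (laplacian_at_max oO Oy sv) => u /andP[u1 u2].
  by apply: vmax; rewrite !ltW.
rewrite (laplacianD oO Oy swO seB) hw add0r (laplacianZ _ oO Oy sB).
have qy : 0 < sqdist a y by exact/pos/ltW.
rewrite laplacian_invr_sqdist // leNgt => /negP; apply.
apply: mulr_gt0 => //; apply: mulr_gt0 => //.
by rewrite invr_gt0 exprn_gt0.
Qed.

End StrongMaximumPrinciple.

(** * The stereographic chart *)

Section Dotp.
Context {R : realType} {n : nat}.
Implicit Types x y : 'rV[R]_n.

Lemma dotpC x y : dotp x y = dotp y x.
Proof. by apply: eq_bigr => i _; rewrite mulrC. Qed.

Lemma dotpNl x y : dotp (- x) y = - dotp x y.
Proof. by rewrite -sumrN; apply: eq_bigr => i _; rewrite mxE mulNr. Qed.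

Lemma coord_sq_le_dotp x i : x 0 i ^+ 2 <= dotp x x.
Proof.
rewrite /dotp (bigD1 i) //= -expr2 lerDl sumr_ge0 // => j _.
by rewrite -expr2 sqr_ge0.
Qed.

End Dotp.

Lemma dotp2E {R : realType} (x y : 'rV[R]_2) :
  dotp x y = x 0 0 * y 0 0 + x 0 1 * y 0 1.
Proof.
rewrite /dotp big_ord_recl big_ord1.
by rewrite (_ : lift ord0 ord0 = 1) //; exact: val_inj.
Qed.

Lemma dotp3E {R : realType} (x y : 'rV[R]_3) :
  dotp x y = x 0 0 * y 0 0 + x 0 1 * y 0 1 + x 0 2 * y 0 2.
Proof.
rewrite /dotp 2!big_ord_recl big_ord1 addrA.
rewrite (_ : lift ord0 ord0 = 1); last exact: val_inj.
by rewrite (_ : lift ord0 _ = 2) //; exact: val_inj.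
Qed.

Lemma ord3P (i : 'I_3) : [\/ i = 0, i = 1 | i = 2].
Proof.
by case: i => [[|[|[|//]]] ?]; [apply: Or31|apply: Or32|apply: Or33]; apply: val_inj.
Qed.

Lemma rp2_projP {R : realType} (x y : S2 R) :
  rp2_proj x = rp2_proj y <-> antipodal x y.
Proof. by split=> [/eqmodP|h]; [|apply/eqmodP]. Qed.

Lemma exists_antipode {R : realType} (x : S2 R) :
  exists2 y : S2 R, val y = - val x & rp2_proj y = rp2_proj x.
Proof.
have Nx : - val x \in @sphere2 R.
  have := set_mem (valP x); rewrite inE /sphere2 /= => xx.
  by rewrite dotpNl dotpC dotpNl opprK.
exists (exist (fun y => y \in @sphere2 R) _ Nx) => //; apply/rp2_projP.
by rewrite /antipodal /= eqxx orbT.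
Qed.

Section Stereographic.
Context {R : realType}.
Implicit Types u v : 'rV[R]_2.

Definition stereo_den u : R := 1 + u 0 0 ^+ 2 + u 0 1 ^+ 2.

Lemma stereo_den_gt0 u : 0 < stereo_den u.
Proof. by rewrite /stereo_den -addrA ltr_pwDl // addr_ge0 // sqr_ge0. Qed.

(** The inverse of the projection from the point (0,0,-1), the last coordinate
    (1 - |u|^2) / (1 + |u|^2) being written as 2 / (1 + |u|^2) - 1. *)
Definition stereo_vec u : 'rV[R]_3 := \row_(j < 3)
  (if j == 0 then 2 * u 0 0 / stereo_den u
   else if j == 1 then 2 * u 0 1 / stereo_den u
   else 2 / stereo_den u - 1).

Lemma stereo_vec_sphere u : stereo_vec u \in @sphere2 R.
Proof.
have d0 := lt0r_neq0 (stereo_den_gt0 u).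
rewrite inE /sphere2 /= dotp3E !mxE /=; move: d0; rewrite /stereo_den => d0.
field; exact: d0.
Qed.

Definition stereo u : S2 R := exist _ (stereo_vec u) (stereo_vec_sphere u).

Lemma is_derive_stereo0 u v : is_derive u v (fun w => stereo_vec w 0 0)
  (2 * v 0 0 / stereo_den u - 4 * u 0 0 * dotp u v / stereo_den u ^+ 2).
Proof.
rewrite (_ : (fun w => _) = fun w : 'rV[R]_2 => 2 * w 0 0 * (stereo_den w)^-1); last first.
  by apply/funext => w; rewrite mxE.
have d0 := lt0r_neq0 (stereo_den_gt0 u).
rewrite /stereo_den; apply: is_derive_eq; first by der.
move: d0; rewrite dotp2E /stereo_den /= ?expr1 => d0; field; exact: d0.
Qed.

Lemma is_derive_stereo1 u v : is_derive u v (fun w => stereo_vec w 0 1)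
  (2 * v 0 1 / stereo_den u - 4 * u 0 1 * dotp u v / stereo_den u ^+ 2).
Proof.
rewrite (_ : (fun w => _) = fun w : 'rV[R]_2 => 2 * w 0 1 * (stereo_den w)^-1); last first.
  by apply/funext => w; rewrite mxE.
have d0 := lt0r_neq0 (stereo_den_gt0 u).
rewrite /stereo_den; apply: is_derive_eq; first by der.
move: d0; rewrite dotp2E /stereo_den /= ?expr1 => d0; field; exact: d0.
Qed.

Lemma is_derive_stereo2 u v : is_derive u v (fun w => stereo_vec w 0 2)
  (- 4 * dotp u v / stereo_den u ^+ 2).
Proof.
rewrite (_ : (fun w => _) = fun w : 'rV[R]_2 => 2 * (stereo_den w)^-1 + -1); last first.
  by apply/funext => w; rewrite mxE.
have d0 := lt0r_neq0 (stereo_den_gt0 u).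
rewrite /stereo_den; apply: is_derive_eq; first by der.
move: d0; rewrite dotp2E /stereo_den /= ?expr1 => d0; field; exact: d0.
Qed.

Lemma smooth_stereo : smooth_on setT stereo_vec.
Proof.
have oT : open [set: 'rV[R]_2] by exact: openT.
have sc (c : R) : smooth_on [set: 'rV[R]_2] (cst c) by exact: smooth_on_cst.
have sx i : smooth_on [set: 'rV[R]_2] (fun u : 'rV[R]_2 => u 0 i).
  exact: smooth_on_coord.
have sd : smooth_on setT (fun u => (stereo_den u)^-1).
  apply: smooth_onV => //; first by move=> u _; exact/lt0r_neq0/stereo_den_gt0.
  apply: smooth_onD => //; last exact: smooth_onX.
  by apply: smooth_onD => //; [exact: (sc 1)|exact: smooth_onX].
apply/(smooth_on_rV _ oT) => j; case: (ord3P j) => ->.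
- rewrite (_ : (fun w => _) = fun w : 'rV[R]_2 => 2 * w 0 0 * (stereo_den w)^-1).
    by apply: smooth_onM => //; apply: smooth_onM => //; exact: (sc 2).
  by apply/funext => w; rewrite mxE.
- rewrite (_ : (fun w => _) = fun w : 'rV[R]_2 => 2 * w 0 1 * (stereo_den w)^-1).
    by apply: smooth_onM => //; apply: smooth_onM => //; exact: (sc 2).
  by apply/funext => w; rewrite mxE.
- rewrite (_ : (fun w => _) = fun w : 'rV[R]_2 => 2 * (stereo_den w)^-1 + -1).
    apply: smooth_onD => //; last exact: (sc (-1)).
    by apply: smooth_onM => //; exact: (sc 2).
  by apply/funext => w; rewrite mxE.
Qed.

Lemma metric_tensor_stereo u :
  metric_tensor stereo u = (4 / stereo_den u ^+ 2)%:M.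
Proof.
have d0 := lt0r_neq0 (stereo_den_gt0 u).
pose F (i : 'I_2) : 'rV[R]_3 := \row_k
  (if k == 0 then
     2 * (i == 0)%:R / stereo_den u - 4 * u 0 0 * u 0 i / stereo_den u ^+ 2
   else if k == 1 then
     2 * (i == 1)%:R / stereo_den u - 4 * u 0 1 * u 0 i / stereo_den u ^+ 2
   else - 4 * u 0 i / stereo_den u ^+ 2).
have dE i : partial_deriv i (fun v => val (stereo v)) u = F i.
  apply/matrixP => k j; rewrite (ord1 k) /partial_deriv derive_mx; last first.
    exact/diff_derivable/(smooth_on_differentiable smooth_stereo).
  rewrite /F 2!mxE; case: (ord3P j) => ->; apply: derive_val.
  - apply: is_derive_eq; first exact: is_derive_stereo0.
    by rewrite dotp2E !mxE; case: (ord2P i) => ->;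
      rewrite /= ?mulr1n ?mulr0n ?mulr1 ?mulr0 ?addr0 ?add0r.
  - apply: is_derive_eq; first exact: is_derive_stereo1.
    by rewrite dotp2E !mxE; case: (ord2P i) => ->;
      rewrite /= ?mulr1n ?mulr0n ?mulr1 ?mulr0 ?addr0 ?add0r.
  - apply: is_derive_eq; first exact: is_derive_stereo2.
    by rewrite dotp2E !mxE; case: (ord2P i) => ->;
      rewrite /= ?mulr1n ?mulr0n ?mulr1 ?mulr0 ?addr0 ?add0r.
apply/matrixP => i j; rewrite /metric_tensor [LHS]mxE [RHS]mxE.
transitivity (dotp (F i) (F j)); first by rewrite -2!dE.
rewrite dotp3E !mxE /=; move: d0; rewrite /stereo_den => d0.
by case: (ord2P i) => ->; case: (ord2P j) => ->;
  rewrite /= ?mulr1n ?mulr0n; field; exact: d0.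
Qed.

Lemma local_param_stereo : local_param setT (@stereo).
Proof.
split; [exact: openT|exact: smooth_stereo|move=> u _].
by rewrite metric_tensor_stereo det_scalar exprn_gt0 // divr_gt0 // exprn_gt0 //
  stereo_den_gt0.
Qed.

(** The stereographic projection is conformal, and in dimension two the
    weight sqrt(det g) g^-1 of a conformal metric g is the identity. *)
Lemma chart_laplacian_stereo h u : chart_laplacian (@stereo) h u =
  - (4 / stereo_den u ^+ 2)^-1 * laplacian h u.
Proof.
have c0 v : 0 < 4 / stereo_den v ^+ 2.
  by rewrite divr_gt0 // exprn_gt0 // stereo_den_gt0.
have sE v : Num.sqrt (\det (metric_tensor stereo v)) = 4 / stereo_den v ^+ 2.
  by rewrite metric_tensor_stereo det_scalar sqrtr_sqr gtr0_norm.
apply: (congr2 (fun s t => - s^-1 * t) (sE u)).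
apply: eq_bigr => i _.
apply: (congr1 (fun k => partial_deriv i k u)).
apply/funext => v.
rewrite sE metric_tensor_stereo invmx_scalar (bigD1 i) //= big1 => [|j ji].
  by rewrite !mxE eqxx mulr1n addr0 mulVKf // lt0r_neq0.
by rewrite !mxE eq_sym (negbTE ji) mulr0n mul0r.
Qed.

(** One of the two representatives of a point lies in the upper half-sphere,
    which is the image of the unit disc. *)
Lemma stereo_unit_ball_onto (p : RP2 R) :
  exists2 u : 'rV[R]_2, (forall i, `|u 0 i| <= 1) & rp2_proj (stereo u) = p.
Proof.
suff H (x : S2 R) : 0 <= val x 0 2 ->
    exists2 u : 'rV[R]_2, (forall i, `|u 0 i| <= 1) & stereo u = x.
  have [x20|x20] := leP 0 (val (repr p) 0 2).
    by have [u u1 ux] := H _ x20; exists u => //; rewrite ux /rp2_proj reprK.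
  have [y yE yp] := exists_antipode (repr p).
  have [|u u1 ux] := H y; first by rewrite yE mxE oppr_ge0 ltW.
  by exists u => //; rewrite ux yp /rp2_proj reprK.
case: x => x xS /= x20.
have : dotp x x = 1 by move: (xS); rewrite inE.
rewrite dotp3E => x1.
have d0 : 1 + x 0 2 != 0 by rewrite lt0r_neq0 // ltr_pwDl.
exists (\row_i (x 0 (if i == 0 then 0 else 1) / (1 + x 0 2))).
  move=> i; rewrite mxE normrM normfV (ger0_norm (x := 1 + _)) ?addr_ge0 //.
  rewrite ler_pdivrMr ?ltr_pwDl // mul1r; set y := x 0 _.
  have : y ^+ 2 <= 1.
    by rewrite /y; case: ifP => _; rewrite -x1; nra.
  move=> y1; apply: (@le_trans _ _ 1); last by rewrite lerDl.
  by rewrite -(@ler_pXn2r _ 2) ?nnegrE // real_normK ?num_real // expr1n.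
apply: val_inj; apply/matrixP => k j; rewrite (ord1 k) /= mxE.
have den : stereo_den (\row_i (x 0 (if i == 0 then 0 else 1) / (1 + x 0 2))) =
    2 / (1 + x 0 2).
  rewrite /stereo_den !mxE /=.
  have -> : 1 + (x 0 0 / (1 + x 0 2)) ^+ 2 + (x 0 1 / (1 + x 0 2)) ^+ 2 =
    ((1 + x 0 2) ^+ 2 + x 0 0 ^+ 2 + x 0 1 ^+ 2) / (1 + x 0 2) ^+ 2.
    by field.
  have -> : (1 + x 0 2) ^+ 2 + x 0 0 ^+ 2 + x 0 1 ^+ 2 = 2 * (1 + x 0 2).
    by nra.
  by field.
by rewrite den; case: (ord3P j) => ->; rewrite !mxE /=; field; rewrite d0.
Qed.

End Stereographic.

(** * Functions with constant Laplacian on the projective plane *)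

Section ProjectivePlaneFunctions.
Context {R : realType}.
Local Notation RP2 := (RP2 R).
Implicit Types (w f g : RP2 -> R) (p r : RP2).

Definition in_chart w (u : 'rV[R]_2) : R := w (rp2_proj (stereo u)).

Lemma smooth_in_chart w : smooth_RP2 w -> smooth_on setT (in_chart w).
Proof. by move=> sw; apply: sw; exact: local_param_stereo. Qed.

Lemma laplace_beltrami_in_chart g f : laplace_beltrami_eq g f ->
  forall u, laplacian (in_chart g) u = - (4 / stereo_den u ^+ 2) * in_chart f u.
Proof.
move=> gf u; rewrite /in_chart -(gf _ _ local_param_stereo u I).
rewrite chart_laplacian_stereo !mulNr mulrN opprK mulrA mulfV ?mul1r //.
by rewrite lt0r_neq0 // divr_gt0 // exprn_gt0 // stereo_den_gt0.
Qed.

(** The chart is not compact, but its values are already taken on a square. *)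
Lemma in_chart_attains_max w : smooth_RP2 w ->
  exists u0, forall u, in_chart w u <= in_chart w u0.
Proof.
move=> sw.
pose K := [set u : 'rV[R]_2 | forall i, u ord0 i \in `[-1, 1]].
have cK : compact K.
  apply: (@rV_compact R _ (fun=> `[-1 : R, 1]%classic)) => _.
  exact: segment_compact.
have K0 : K !=set0.
  by exists 0 => i; rewrite mxE in_itv /= oppr_le0 ler01.
have cw : {within K, continuous (in_chart w)}.
  apply: continuous_in_subspaceT => u _; apply: differentiable_continuous.
  exact: (smooth_in_chart sw [::]).
have [u0 _ u0max] := EVT_max_rV K0 cK cw.
exists u0 => u.
have [u' u'1 u'E] := stereo_unit_ball_onto (rp2_proj (stereo u)).
rewrite {1}/in_chart -u'E; apply: u0max; rewrite inE => i.
by rewrite in_itv /= -ler_norml.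
Qed.

(** The Laplacian, with nonnegative eigenvalues, is nonnegative at a maximum. *)
Lemma constant_laplacian_sign w c : smooth_RP2 w ->
  (forall u, laplacian (in_chart w) u = - (4 / stereo_den u ^+ 2) * c) -> 0 <= c.
Proof.
move=> sw wc; have [u0 u0max] := in_chart_attains_max sw.
have := laplacian_at_max openT I (smooth_in_chart sw) (fun u _ => u0max u).
by rewrite wc mulNr oppr_le0 pmulr_rge0 // divr_gt0 // exprn_gt0 // stereo_den_gt0.
Qed.

Lemma smooth_RP2_cst c : smooth_RP2 (fun _ : RP2 => c : R).
Proof. by move=> U psi [oU _ _]; exact: (smooth_on_cst c oU). Qed.

Lemma smooth_RP2D f g :
  smooth_RP2 f -> smooth_RP2 g -> smooth_RP2 (fun p => f p + g p).
Proof.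
move=> sf sg U psi Upsi; have [oU _ _] := Upsi.
by apply: smooth_onD => //; [exact: sf|exact: sg].
Qed.

Lemma smooth_RP2M f g :
  smooth_RP2 f -> smooth_RP2 g -> smooth_RP2 (fun p => f p * g p).
Proof.
move=> sf sg U psi Upsi; have [oU _ _] := Upsi.
by apply: smooth_onM => //; [exact: sf|exact: sg].
Qed.

Lemma smooth_RP2X f n : smooth_RP2 f -> smooth_RP2 (fun p => f p ^+ n).
Proof.
by move=> sf U psi Upsi; have [oU _ _] := Upsi; apply: smooth_onX => //; exact: sf.
Qed.

(** A minimum is treated as a maximum of -w, whence c = 0; then w is harmonic in
    the chart, where it attains its maximum. *)
Lemma constant_laplacian w c : smooth_RP2 w ->
  (forall u, laplacian (in_chart w) u = - (4 / stereo_den u ^+ 2) * c) ->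
  c = 0 /\ forall p r, w p = w r.
Proof.
move=> sw wc; have sT := smooth_in_chart sw.
have c0 : c = 0.
  apply/eqP; rewrite eq_le (constant_laplacian_sign sw wc) andbT.
  rewrite -oppr_ge0; apply: (@constant_laplacian_sign (fun p => -1 * w p)).
    by apply: smooth_RP2M => //; exact: smooth_RP2_cst.
  move=> u; rewrite (laplacianZ (-1) openT I sT) wc; ring.
split=> //; have [u0 u0max] := in_chart_attains_max sw.
have wE p : w p = in_chart w u0.
  have [u _ <-] := stereo_unit_ball_onto p.
  rewrite -/(in_chart w u); apply: harmonic_at_max_cst => // v.
  by rewrite wc c0 mulr0.
by move=> p r; rewrite !wE.
Qed.

End ProjectivePlaneFunctions.

Section Zonal.
Context {R : realType}.
Local Notation RP2 := (RP2 R).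
Implicit Types (p r : RP2) (x : S2 R).

(** The square of the cosine of the distance from p to r. *)
Definition cos2 p r : R := dotp (val (repr p)) (val (repr r)) ^+ 2.

Lemma val_repr_proj x :
  val (repr (rp2_proj x)) = val x \/ val (repr (rp2_proj x)) = - val x.
Proof.
have /rp2_projP/orP[/eqP|/eqP] : rp2_proj (repr (rp2_proj x)) = rp2_proj x.
- by rewrite /rp2_proj reprK.
- by left.
- by right.
Qed.

Lemma cos2_projl x r : cos2 (rp2_proj x) r = dotp (val x) (val (repr r)) ^+ 2.
Proof.
by rewrite /cos2; have [->|->] := val_repr_proj x; rewrite ?dotpNl ?sqrrN.
Qed.

Lemma dotp_repr r : dotp (val (repr r)) (val (repr r)) = 1.
Proof. by have := set_mem (valP (repr r)). Qed.

Lemma cos2_ge0 p r : 0 <= cos2 p r.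
Proof. exact: sqr_ge0. Qed.

Lemma cos2pp r : cos2 r r = 1.
Proof. by rewrite /cos2 dotp_repr expr1n. Qed.

(** Lagrange: 1 - <x,y>^2 is the squared norm of the cross product. *)
Lemma cos2_le1 p r : cos2 p r <= 1.
Proof.
rewrite /cos2; have := dotp_repr p; have := dotp_repr r.
move: (val (repr p)) (val (repr r)) => x y; rewrite !dotp3E => y1 x1.
have -> : 1 = (x 0 0 * x 0 0 + x 0 1 * x 0 1 + x 0 2 * x 0 2) *
  (y 0 0 * y 0 0 + y 0 1 * y 0 1 + y 0 2 * y 0 2) by rewrite x1 y1 mulr1.
rewrite -subr_ge0.
have -> : forall a b c d e f : R, (a * a + b * b + c * c) * (d * d + e * e + f * f)
   - (a * d + b * e + c * f) ^+ 2 =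
   (a * e - b * d) ^+ 2 + (a * f - c * d) ^+ 2 + (b * f - c * e) ^+ 2.
  by move=> *; ring.
by rewrite !addr_ge0 // sqr_ge0.
Qed.

Lemma smooth_cos2 r : smooth_RP2 (cos2 ^~ r).
Proof.
move=> U psi [oU spsi _].
rewrite (_ : (fun u => _) =
    (fun u => dotp (val (psi u)) (val (repr r)) ^+ 2)); last first.
  by apply/funext => u; rewrite cos2_projl.
apply: smooth_onX => //; apply: smooth_on_sum => // i.
apply: smooth_onM => //; last exact: smooth_on_cst.
by move: i; exact/(smooth_on_rV _ oU).
Qed.

(** With h = <stereo_vec, y>, the gradient of h has squared norm L (1 - h^2) and
    the Laplacian of h is -2 L h, where L = 4 / stereo_den^2 is the conformal
    factor; the formula follows by the chain rule. *)
Lemma laplacian_height_pow (y : 'rV[R]_3) n u : dotp y y = 1 ->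
  laplacian (fun v => dotp (stereo_vec v) y ^+ n.+2) u =
  4 / stereo_den u ^+ 2 * (n.+2%:R * (n.+1%:R * dotp (stereo_vec u) y ^+ n
                           - n.+3%:R * dotp (stereo_vec u) y ^+ n.+2)).
Proof.
move=> y1; set t := fun v => dotp (stereo_vec v) y.
pose A (v : 'rV[R]_2) := 2 * (v 0 0 * y 0 0 + v 0 1 * y 0 1 + y 0 2).
have y1' : y 0 0 ^+ 2 + y 0 1 ^+ 2 = 1 - y 0 2 ^+ 2.
  by rewrite -y1 dotp3E; ring.
have d0 (v : 'rV[R]_2) := lt0r_neq0 (stereo_den_gt0 v).
pose yi (i : 'I_2) := if i == 0 then y 0 0 else y 0 1.
have tE v : t v = A v / stereo_den v - y 0 2.
  rewrite /t dotp3E /stereo_vec !mxE /= /A; field; exact: d0.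
(* t1 and t2 are the first and the second derivatives of t. *)
pose t1 (i : 'I_2) (v : 'rV[R]_2) :=
  2 * yi i / stereo_den v - 2 * v 0 i * A v / stereo_den v ^+ 2.
pose t2 (i : 'I_2) (v : 'rV[R]_2) := - 8 * yi i * v 0 i / stereo_den v ^+ 2
   - 2 * A v / stereo_den v ^+ 2 + 8 * v 0 i ^+ 2 * A v / stereo_den v ^+ 3.
have dden v (i : 'I_2) : is_derive v (delta_mx 0 i) (@stereo_den R) (2 * v 0 i).
  rewrite /stereo_den; apply: is_derive_eq; first by der.
  by rewrite !mxE; case: (ord2P i) => ->; rewrite /= ?mulr1n ?mulr0n; ring.
have dA v (i : 'I_2) : is_derive v (delta_mx 0 i) A (2 * yi i).
  rewrite /A; apply: is_derive_eq; first by der.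
  by rewrite !mxE /yi; case: (ord2P i) => ->; rewrite /= ?mulr1n ?mulr0n; ring.
have dt v (i : 'I_2) : is_derive v (delta_mx 0 i) t (t1 i v).
  rewrite (_ : t = fun v => A v * (stereo_den v)^-1 + - y 0 2); last first.
    by apply/funext => x; rewrite tE.
  apply: is_derive_eq; first by der; first [exact: dA|exact: d0|exact: dden].
  rewrite /t1; move: (d0 v); move: (stereo_den v) => d dn0; field; exact: dn0.
have dt1 v (i : 'I_2) : is_derive v (delta_mx 0 i) (t1 i) (t2 i v).
  rewrite /t1; apply: is_derive_eq.
    by der; first [exact: d0|exact: dden|exact: dA|exact: expf_neq0].
  rewrite /t2 !mxE !eqxx /=; move: (d0 v); move: (stereo_den v) => d dn0.
  rewrite /GRing.scale /=; field; exact: dn0.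
have dd : u 0 0 ^+ 2 + u 0 1 ^+ 2 = stereo_den u - 1 by rewrite /stereo_den; ring.
have S1 : t1 0 u ^+ 2 + t1 1 u ^+ 2 = 4 / stereo_den u ^+ 2 * (1 - t u ^+ 2).
  have AE : u 0 0 * y 0 0 + u 0 1 * y 0 1 = A u / 2 - y 0 2 by rewrite /A; field.
  have -> : t1 0 u ^+ 2 + t1 1 u ^+ 2 =
     4 * (y 0 0 ^+ 2 + y 0 1 ^+ 2) / stereo_den u ^+ 2
     - 8 * (u 0 0 * y 0 0 + u 0 1 * y 0 1) * A u / stereo_den u ^+ 3
     + 4 * (u 0 0 ^+ 2 + u 0 1 ^+ 2) * A u ^+ 2 / stereo_den u ^+ 4.
    rewrite /t1 /yi /=; move: (d0 u); move: (stereo_den u) (A u) => d a dn0.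
    by field.
  rewrite AE dd y1' tE; move: (d0 u); move: (stereo_den u) (A u) => d a dn0.
  by field.
have S2 : t2 0 u + t2 1 u = - (8 / stereo_den u ^+ 2 * t u).
  have AE : u 0 0 * y 0 0 + u 0 1 * y 0 1 = A u / 2 - y 0 2 by rewrite /A; field.
  have -> : t2 0 u + t2 1 u =
     - 8 * (u 0 0 * y 0 0 + u 0 1 * y 0 1) / stereo_den u ^+ 2
     - 4 * A u / stereo_den u ^+ 2
     + 8 * (u 0 0 ^+ 2 + u 0 1 ^+ 2) * A u / stereo_den u ^+ 3.
    rewrite /t2 /yi /=; move: (d0 u); move: (stereo_den u) (A u) => d a dn0.
    by field.
  rewrite AE dd tE; move: (d0 u); move: (stereo_den u) (A u) => d a dn0.
  by field.
have D1 (i : 'I_2) : partial_deriv i (fun v => t v ^+ n.+2) =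
    (fun v => n.+2%:R * t v ^+ n.+1 * t1 i v).
  by apply/funext => v; apply: derive_val; apply: is_derive_expf.
have D2 (i : 'I_2) : partial_deriv i (partial_deriv i (fun v => t v ^+ n.+2)) u =
    n.+2%:R * n.+1%:R * t u ^+ n * t1 i u ^+ 2 + n.+2%:R * t u ^+ n.+1 * t2 i u.
  rewrite D1; apply: derive_val; apply: is_derive_eq.
    by der; first [exact: dt|exact: dt1].
  by rewrite /= ; ring.
rewrite laplacianE !D2 -/(t u).
transitivity (n.+2%:R * n.+1%:R * t u ^+ n * (t1 0 u ^+ 2 + t1 1 u ^+ 2) +
  n.+2%:R * t u ^+ n.+1 * (t2 0 u + t2 1 u)); first by ring.
rewrite S1 S2 -(natr1 n.+2) -(natr1 n.+1) !exprS; field; exact: d0.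
Qed.

End Zonal.

(** * Truncated Green kernels and integration *)

Section TruncatedKernel.
Context {R : realType}.
Local Notation RP2 := (RP2 R).
Implicit Types (s : R) (p r : RP2).

(** The sum of the n first terms (s^k - 1/(2k+1)) / (2k), k = j + 1, of the
    expansion of the Green function at s = cos2. *)
Definition green_trunc n s : R :=
  \sum_(j < n) (s ^+ j.+1 - (j.*2.+3)%:R^-1) / (j.*2.+2)%:R.

Lemma green_truncS n s : green_trunc n.+1 s =
  green_trunc n s + (n.*2.+2)%:R^-1 * (s ^+ n.+1 - (n.*2.+3)%:R^-1).
Proof. by rewrite /green_trunc big_ord_recr /= mulrC. Qed.

Lemma smooth_green_trunc n r : smooth_RP2 (fun p => green_trunc n (cos2 p r)).
Proof.
elim: n => [|n IH].
  rewrite (_ : (fun p => _) = fun=> 0); first exact: smooth_RP2_cst.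
  by apply/funext => p; rewrite /green_trunc big_ord0.
rewrite (_ : (fun p => _) = fun p => green_trunc n (cos2 p r) +
    (n.*2.+2)%:R^-1 * (cos2 p r ^+ n.+1 + - (n.*2.+3)%:R^-1)); last first.
  by apply/funext => p; rewrite green_truncS.
apply: smooth_RP2D => //; apply: smooth_RP2M; first exact: smooth_RP2_cst.
apply: smooth_RP2D; last exact: smooth_RP2_cst.
exact/smooth_RP2X/smooth_cos2.
Qed.

Lemma laplacian_cst (b : R) u : laplacian (fun _ => b) u = 0.
Proof.
rewrite /laplacian big1 // => i _.
rewrite (_ : partial_deriv i (fun=> b) = cst 0); first exact: derive_cst.
by apply/funext => v; exact: derive_cst.
Qed.

(** The spherical Laplacian of <.,y>^(2k)/(2k), with nonnegative eigenvalues, is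
    (2k+1) <.,y>^(2k) - (2k-1) <.,y>^(2k-2), so that the sum telescopes. The
    plane Laplacian has the opposite sign and carries the conformal factor. *)
Lemma laplacian_green_trunc n r u :
  laplacian (in_chart (fun p => green_trunc n (cos2 p r))) u =
  4 / stereo_den u ^+ 2 *
    (1 - (n.*2.+1)%:R * cos2 (rp2_proj (stereo u)) r ^+ n).
Proof.
elim: n => [|n IH].
  rewrite expr0 mulr1 subrr mulr0 /in_chart (_ : (fun u => _) = fun=> 0).
    exact: laplacian_cst.
  by apply/funext => v; rewrite /green_trunc big_ord0.
pose h v := dotp (stereo_vec v) (val (repr r)) ^+ (n.*2.+2).
pose a : R := (n.*2.+2)%:R^-1; pose b := - (a * (n.*2.+3)%:R^-1).
have hE v : cos2 (rp2_proj (stereo v)) r ^+ n.+1 = h v.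
  by rewrite cos2_projl -exprM mul2n doubleS.
have sh : smooth_on setT h.
  apply: smooth_onX; first exact: openT.
  apply: smooth_on_sum => [|i]; first exact: openT.
  apply: smooth_onM; [exact: openT| |exact/smooth_on_cst/openT].
  by move: i; apply/(smooth_on_rV _ openT); exact: smooth_stereo.
have sah : smooth_on setT (fun v => a * h v).
  by apply: smooth_onM => //; [exact: openT|exact/smooth_on_cst/openT].
have sb : smooth_on [set: 'rV[R]_2] (fun _ => b) by exact/smooth_on_cst/openT.
have sn := smooth_in_chart (smooth_green_trunc n r).
rewrite (_ : in_chart _ = fun v =>
    in_chart (fun p => green_trunc n (cos2 p r)) v + (a * h v + b)); last first.
  apply/funext => v; rewrite /in_chart green_truncS hE -/a /b; ring.
rewrite (laplacianD openT I sn (smooth_onD openT sah sb)).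
rewrite (laplacianD openT I sah sb) (laplacianZ _ openT I sh) laplacian_cst addr0.
rewrite IH hE (laplacian_height_pow _ _ (dotp_repr r)) -/(h u).
rewrite cos2_projl -exprM mul2n.
rewrite doubleS /a; field.
by rewrite -natrD pnatr_eq0 andbT lt0r_neq0 // stereo_den_gt0.
Qed.

End TruncatedKernel.

Section Integration.
Context {R : realType}.
Local Notation RP2 := (RP2 R).
Context (sigma : probability (borelRP2 R) R).
Implicit Types f g : RP2 -> R.

Definition bounded_borel f : Prop :=
  measurable_fun setT (f : borelRP2 R -> R) /\ exists M, forall p, `|f p| <= M.

Lemma bounded_borel_cst c : bounded_borel (fun=> c).
Proof. by split; [exact: measurable_cst|exists `|c|]. Qed.

Lemma bounded_borelD f g : bounded_borel f -> bounded_borel g ->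
  bounded_borel (fun p => f p + g p).
Proof.
move=> [mf [M fM]] [mg [N gN]]; split; first exact: measurable_funD.
exists (M + N) => p; exact: le_trans (ler_normD _ _) (lerD (fM p) (gN p)).
Qed.

Lemma bounded_borelM f g : bounded_borel f -> bounded_borel g ->
  bounded_borel (fun p => f p * g p).
Proof.
move=> [mf [M fM]] [mg [N gN]]; split; first exact: measurable_funM.
by exists (M * N) => p; rewrite normrM ler_pM.
Qed.

Lemma bounded_borel_sum (I : Type) (s : seq I) (P : pred I) (F : I -> RP2 -> R) :
  (forall i, bounded_borel (F i)) ->
  bounded_borel (fun p => \sum_(i <- s | P i) F i p).
Proof.
move=> bF; elim: s => [|i s IH].
  by under eq_fun do rewrite big_nil; exact: bounded_borel_cst.
under eq_fun do rewrite big_cons; case: (P i) => //.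
exact: bounded_borelD.
Qed.

Lemma bounded_borelX f n : bounded_borel f -> bounded_borel (fun p => f p ^+ n).
Proof.
move=> bf; elim: n => [|n IH]; first exact: bounded_borel_cst.
by under eq_fun do rewrite exprS; exact: bounded_borelM.
Qed.

Lemma bounded_borel_integrable f : bounded_borel f ->
  sigma.-integrable setT (EFin \o f).
Proof.
move=> [mf [M fM]]; apply: measurable_bounded_integrable => //.
  by apply: le_lt_trans (probability_le1 sigma measurableT) _; exact: ltry.
exists M; split; first exact: num_real.
by move=> N MN p _; apply: le_trans (fM p) (ltW MN).
Qed.

Lemma integrable_mul_bounded (h : RP2 -> R) f :
  sigma.-integrable setT (EFin \o h) -> bounded_borel f ->
  sigma.-integrable setT (EFin \o (fun p => h p * f p)).
Proof.
move=> ih [mf [M fM]].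
rewrite (_ : _ \o _ = (EFin \o h) \* (EFin \o f))%E; last first.
  by apply/funext => p /=; rewrite EFinM.
apply: integrableMl => //.
exists M; split; first exact: num_real.
by move=> N MN p _; apply: le_trans (fM p) (ltW MN).
Qed.

Lemma integrable_addf f g :
  sigma.-integrable setT (EFin \o f) -> sigma.-integrable setT (EFin \o g) ->
  sigma.-integrable setT (EFin \o (fun p => f p + g p)).
Proof.
by move=> fi gi; have := integrableD measurableT fi gi; apply: eq_integrable.
Qed.

Lemma Rintegral_cst1 (c : R) : \int[sigma]_x c = c.
Proof.
by rewrite Rintegral_cst // [X in fine X](probability_setT sigma) mulr1.
Qed.

Lemma Rintegral_bounded_sum (I : Type) (s : seq I) (P : pred I)
    (F : I -> RP2 -> R) :
  (forall i, bounded_borel (F i)) ->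
  \int[sigma]_x (\sum_(i <- s | P i) F i x) =
  \sum_(i <- s | P i) \int[sigma]_x F i x.
Proof.
move=> bF; elim: s => [|i s IH].
  rewrite big_nil; under eq_Rintegral do rewrite big_nil.
  exact: Rintegral_cst1.
rewrite big_cons; under eq_Rintegral do rewrite big_cons.
case: (P i) => //; rewrite RintegralD ?IH //.
  exact/bounded_borel_integrable.
exact/bounded_borel_integrable/bounded_borel_sum.
Qed.

Lemma continuous_measurable_RP2 f : continuous f ->
  measurable_fun setT (f : borelRP2 R -> R).
Proof.
move=> /continuousP cf; apply: (measurability _ (RGenOpens.measurableE R)).
move=> _ [_ [a [b ->] <-]]; rewrite setTI; apply: sub_sigma_algebra.
exact/cf/interval_open.
Qed.

(** The coordinates of the chosen representative need not be continuous in the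
    point, but an even function does not see the choice. *)
Lemma even_continuous_RP2 (F : 'rV[R]_3 -> R) : continuous F ->
  (forall v, F (- v) = F v) -> continuous (fun p : RP2 => F (val (repr p))).
Proof.
move=> cF evenF; apply/quotient_continuous.
rewrite (_ : _ \o _ = F \o (@set_val _ (@sphere2 R))).
  move=> x; apply: continuous_comp; last exact: cF.
  exact: initial_continuous.
apply/funext => x /=; rewrite /= -/(rp2_proj x).
by have [->|->] := val_repr_proj x.
Qed.

End Integration.

(** * Green potentials of powers of the cosine *)

Section GreenPotential.
Context {R : realType}.
Local Notation RP2 := (RP2 R).
Context (sigma : probability (borelRP2 R) R) (G : RP2 -> RP2 -> R)
  (G_green : is_green_function sigma G).
Implicit Types p r x : RP2.

Lemma bounded_borel_cos2 r : @bounded_borel R (cos2 ^~ r).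
Proof.
split; last by exists 1 => p; rewrite ger0_norm ?cos2_ge0 ?cos2_le1.
apply: continuous_measurable_RP2.
apply: (even_continuous_RP2 (F := fun v => dotp v (val (repr r)) ^+ 2)).
  have sF : smooth_on setT (fun v : 'rV[R]_3 => dotp v (val (repr r)) ^+ 2).
    apply: smooth_onX; first exact: openT.
    apply: smooth_on_sum => [|i]; first exact: openT.
    apply: smooth_onM; [exact: openT| |exact/smooth_on_cst/openT].
    exact/smooth_on_coord/openT.
  by move=> v; apply: differentiable_continuous; exact: (sF [::]).
by move=> v; rewrite dotpNl sqrrN.
Qed.

Let f c n r p : R := (n.*2.+1)%:R * cos2 p r ^+ n + - c.

Let power_mass n r : R := \int[sigma]_p ((n.*2.+1)%:R * cos2 p r ^+ n).

Let green_solution n r (c := power_mass n r) :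
  [/\ smooth_RP2 (potential sigma G (f c n r)),
      laplace_beltrami_eq (potential sigma G (f c n r)) (f c n r) &
      \int[sigma]_x potential sigma G (f c n r) x = 0].
Proof.
case: G_green => _ _ _; apply.
  apply: smooth_RP2D; last exact: smooth_RP2_cst.
  by apply: smooth_RP2M; [exact: smooth_RP2_cst|exact/smooth_RP2X/smooth_cos2].
rewrite RintegralD ?Rintegral_cst1 ?subrr //; last first.
  exact/bounded_borel_integrable/bounded_borel_cst.
apply/bounded_borel_integrable/bounded_borelM; first exact: bounded_borel_cst.
exact/bounded_borelX/bounded_borel_cos2.
Qed.

(** The Laplacian of the potential is (2n+1) cos2^n - c, and that of the
    truncated kernel is (2n+1) cos2^n - 1. *)
Let error_constant n r (c := power_mass n r)
    (w := fun p =>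
       potential sigma G (f c n r) p + -1 * green_trunc n (cos2 p r)) :
  1 - c = 0 /\ forall p q, w p = w q.
Proof.
have [sP lP _] := green_solution n r.
have sT := smooth_in_chart (smooth_green_trunc n r).
have sP' := smooth_in_chart sP.
have sT' : smooth_on setT
    (fun u => -1 * in_chart (fun p => green_trunc n (cos2 p r)) u).
  by apply: smooth_onM => //; [exact: openT|exact/smooth_on_cst/openT].
apply: constant_laplacian.
  apply: smooth_RP2D => //; apply: smooth_RP2M; first exact: smooth_RP2_cst.
  exact: smooth_green_trunc.
move=> u; rewrite (_ : in_chart w = fun u =>
  in_chart (potential sigma G (f c n r)) u +
  -1 * in_chart (fun p => green_trunc n (cos2 p r)) u) //.
rewrite (laplacianD openT I sP' sT') (laplacianZ _ openT I sT).
rewrite (laplace_beltrami_in_chart lP) laplacian_green_trunc /in_chart /f -/c.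
ring.
Qed.

Lemma moment_cos2 n r : \int[sigma]_p cos2 p r ^+ n = (n.*2.+1)%:R^-1.
Proof.
have [/eqP + _] := error_constant n r; rewrite subr_eq0 => /eqP c1.
apply: (@mulfI _ (n.*2.+1)%:R); first by rewrite pnatr_eq0.
rewrite mulfV ?pnatr_eq0 // [RHS]c1 /power_mass RintegralZl //.
exact/bounded_borel_integrable/bounded_borelX/bounded_borel_cos2.
Qed.

Lemma mean_green_trunc n r : \int[sigma]_p green_trunc n (cos2 p r) = 0.
Proof.
rewrite /green_trunc Rintegral_bounded_sum => [|j].
  rewrite big1 // => j _; rewrite RintegralZr //.
    rewrite RintegralB // ?moment_cos2 ?Rintegral_cst1 ?subrr ?mul0r //.
      exact/bounded_borel_integrable/bounded_borelX/bounded_borel_cos2.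
    exact/bounded_borel_integrable/bounded_borel_cst.
  apply/bounded_borel_integrable/bounded_borelD; last exact: bounded_borel_cst.
  exact/bounded_borelX/bounded_borel_cos2.
apply: bounded_borelM; last exact: bounded_borel_cst.
apply: bounded_borelD; last exact: bounded_borel_cst.
exact/bounded_borelX/bounded_borel_cos2.
Qed.

Lemma bounded_borel_green_trunc n r :
  bounded_borel (fun p => green_trunc n (cos2 p r)).
Proof.
apply: bounded_borel_sum => j; apply: bounded_borelM; last exact: bounded_borel_cst.
apply: bounded_borelD; last exact: bounded_borel_cst.
exact/bounded_borelX/bounded_borel_cos2.
Qed.

(** The potential and the truncated kernel have mean zero, so the constant by
    which they differ vanishes; the mean c = 1 contributes nothing to the
    potential because G x has mean zero. *)
Lemma green_potential_power n r x :
  \int[sigma]_p (G x p * ((n.*2.+1)%:R * cos2 p r ^+ n)) =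
  green_trunc n (cos2 x r).
Proof.
have [/eqP + w_cst] := error_constant n r; rewrite subr_eq0 => /eqP c1.
have [_ _ P0] := green_solution n r.
case: G_green => _ iG G0 _.
set P := potential sigma G _ in w_cst P0.
have PE p : P p = green_trunc n (cos2 p r) + (P x - green_trunc n (cos2 x r)).
  by have := w_cst p x; rewrite -!/(P _); lra.
have Px : P x = green_trunc n (cos2 x r).
  apply/eqP; rewrite -subr_eq0; apply/eqP; rewrite -[RHS]P0.
  under [RHS]eq_Rintegral do rewrite PE.
  rewrite RintegralD // ?mean_green_trunc ?Rintegral_cst1 ?add0r //.
    exact/bounded_borel_integrable/bounded_borel_green_trunc.
  exact/bounded_borel_integrable/bounded_borel_cst.
rewrite -Px /P /potential -/(power_mass n r) -c1 /f.
under [RHS]eq_Rintegral do rewrite mulrDr mulrN1.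
rewrite RintegralB //.
- by rewrite G0 subr0.
- apply: integrable_mul_bounded; [exact: iG|apply: bounded_borelM].
    exact: bounded_borel_cst.
  exact/bounded_borelX/bounded_borel_cos2.
- exact: iG.
Qed.

End GreenPotential.

(** * Concentration of the powers of the cosine *)

Section Localization.
Context {R : realType}.
Local Notation RP2 := (RP2 R).

Lemma sqdist_sphere (x y : 'rV[R]_3) : dotp x x = 1 -> dotp y y = 1 ->
  dotp (y - x) (y - x) = 2 - 2 * dotp y x.
Proof. by rewrite !dotp3E !mxE => x1 y1; nra. Qed.

Lemma sphere_near_ball (x y : 'rV[R]_3) (e : R) :
  0 < e -> dotp x x = 1 -> dotp y y = 1 ->
  1 - e ^+ 2 / 2 < dotp y x -> ball x e y.
Proof.
move=> e0 x1 y1 exy; split => // i j; rewrite (ord1 i) /ball /=.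
rewrite -(@ltr_pXn2r _ 2) ?nnegrE ?(ltW e0) // real_normK ?num_real //.
apply: (@le_lt_trans _ _ (dotp (y - x) (y - x))); last first.
  by rewrite sqdist_sphere //; lra.
by rewrite -sqrrN opprB; have := coord_sq_le_dotp (y - x) j; rewrite !mxE.
Qed.

(** A neighbourhood of r lifts to an open set containing two small balls around
    the antipodal representatives of r, and a representative of p falls into one
    of them when cos2 p r is close to 1. *)
Lemma nbhs_cos2 (r : RP2) (V : set RP2) : nbhs r V ->
  exists2 d : R, 0 < d < 1 & forall p, d < cos2 p r -> V p.
Proof.
rewrite nbhsE => -[W [oW Wr] WV].
have : open (@rp2_proj R @^-1` W : set (S2 R)) by [].
move=> [Q oQ QW].
have inQ (x : S2 R) : Q (val x) <-> W (rp2_proj x).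
  by move: QW => /seteqP[h1 h2]; split; [exact: h1|exact: h2].
have Qr : Q (val (repr r)) by apply/inQ; rewrite /rp2_proj reprK.
have [rN rNE rNr] := exists_antipode (repr r).
have QrN : Q (- val (repr r)).
  by rewrite -rNE; apply/inQ; rewrite rNr /rp2_proj reprK.
have /nbhs_ballP[e1 /= e10 Qe1] := open_nbhs_nbhs (conj oQ Qr).
have /nbhs_ballP[e2 /= e20 Qe2] := open_nbhs_nbhs (conj oQ QrN).
pose e := Num.min e1 e2; have e0 : 0 < e by rewrite lt_min e10 e20.
have [ee1 ee2] : e <= e1 /\ e <= e2 by rewrite !ge_min !lexx orbT.
have esq : 0 < e ^+ 2 by rewrite exprn_gt0.
(* |cos| >= cos^2 > 1 - e^2/2, and |x - y|^2 = 2 - 2 <x,y> on the sphere. *)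
exists (Num.max (1 / 2) (1 - e ^+ 2 / 2)).
  rewrite lt_max gt_max; apply/andP.
  by split; [apply/orP; left|apply/andP; split]; lra.
move=> p; rewrite gt_max => /andP[_ dp]; apply: WV.
rewrite -[p]reprK -/(rp2_proj (repr p)); apply/inQ.
have p1 := dotp_repr p; have r1 := dotp_repr r.
have := cos2_le1 p r; rewrite /cos2 in dp *; set t := dotp _ _ in dp * => t2.
have [t0|t0] := leP 0 t.
  apply/Qe1/(le_ball ee1)/sphere_near_ball => //; rewrite -/t.
  by apply: lt_le_trans dp _; nra.
apply/Qe2/(le_ball ee2)/sphere_near_ball => //.
  by rewrite dotpNl dotpC dotpNl opprK.
rewrite dotpC dotpNl dotpC -/t.
by apply: lt_le_trans dp _; nra.
Qed.

(** With l = - ln d, the power d^n = exp(-nl) is at most 2/(nl)^2, so that the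
    product is O(1/n). *)
Lemma linear_geometric_small (d C e : R) : 0 < d < 1 -> 0 <= C -> 0 < e ->
  forall N, exists2 n, (N <= n)%N & (n.*2.+1)%:R * d ^+ n * C <= e.
Proof.
move=> /andP[d0 d1] C0 e0 N.
pose l := - ln d; have l0 : 0 < l by rewrite oppr_gt0 ln_lt0 // d0.
have dE n : d ^+ n = (expR (n%:R * l))^-1.
  by rewrite -expRN mulrN opprK expRM_natl lnK.
pose B := 6 * C / (l ^+ 2 * e).
have B0 : 0 <= B by rewrite divr_ge0 ?mulr_ge0 // ltW // mulr_gt0 // exprn_gt0.
have [n [Nn nB n1]] : exists n, [/\ (N <= n)%N, B <= n%:R & 1 <= n%:R :> R].
  exists (N + (Num.bound B).+1)%N; split; first by rewrite leq_addr.
    apply: le_trans (ltW (archi_boundP B0)) _; rewrite ler_nat.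
    by rewrite addnS -addSn leq_addl.
  by rewrite ler1n addnS.
exists n => //.
have n0 : 0 < n%:R :> R by apply: lt_le_trans n1.
have ex : (n%:R * l) ^+ 2 / 2 <= expR (n%:R * l).
  have := expR_ge1Dxn 1 (mulr_ge0 (ltW n0) (ltW l0)); apply: le_trans.
  by rewrite lerDr.
have nl2 : 0 < (n%:R * l) ^+ 2 / 2 by rewrite divr_gt0 // exprn_gt0 // mulr_gt0.
have dn : d ^+ n <= ((n%:R * l) ^+ 2 / 2)^-1.
  by rewrite dE lef_pV2 // ?posrE ?expR_gt0.
have n3 : (n.*2.+1)%:R <= 3 * n%:R :> R.
  by rewrite -mul2n -natr1 natrM; lra.
apply: (@le_trans _ _ (3 * n%:R * ((n%:R * l) ^+ 2 / 2)^-1 * C)).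
  by rewrite ler_wpM2r // ler_pM // exprn_ge0 // ltW.
rewrite (_ : _ * C = B * e / n%:R); last first.
  by rewrite /B; field; rewrite !lt0r_neq0.
by rewrite ler_pdivrMr // mulrC ler_wpM2l // ltW.
Qed.

End Localization.

(** * The truncated kernels bound the Green function from below *)

Section LowerBound.
Context {R : realType}.
Local Notation RP2 := (RP2 R).

(** The term of index k is at least - 1/(2k(2k+1)), hence at least
    - 1/(4k(k-1)) = 1/(4k) - 1/(4(k-1)), which telescopes. *)
Lemma green_trunc_tail N n (s : R) : 0 <= s -> (0 < N)%N -> (N <= n)%N ->
  green_trunc N s - (4 * N%:R)^-1 + (4 * n%:R)^-1 <= green_trunc n s.
Proof.
move=> s0 N0; elim: n => [|n IH].
  by rewrite leqn0 => /eqP NE; rewrite NE in N0.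
rewrite leq_eqVlt => /predU1P[->|]; first by rewrite subrK.
rewrite ltnS => Nn; have := IH Nn; rewrite green_truncS.
have n0 : 0 < n%:R :> R by rewrite ltr0n (leq_trans N0).
have E : (4 * n%:R)^-1 - (4 * n.+1%:R)^-1 = (4 * n%:R * (n%:R + 1))^-1 :> R.
  rewrite -natr1; field.
  by rewrite (lt0r_neq0 n0) lt0r_neq0 ?addr_gt0.
have B : - (4 * n%:R * (n%:R + 1))^-1 <=
    (n.*2.+2)%:R^-1 * (s ^+ n.+1 - (n.*2.+3)%:R^-1) :> R.
  apply: (@le_trans _ _ (- ((n.*2.+2)%:R^-1 * (n.*2.+3)%:R^-1))).
    rewrite lerN2 -invfM lef_pV2 ?posrE; last 2 first.
    - by rewrite mulr_gt0 // ltr0n.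
    - by rewrite !mulr_gt0 // addr_gt0.
    rewrite -muln2 -!natr1 natrM; nra.
  by rewrite -mulrN ler_wpM2l // -lerBlDr ?opprK ?addNr ?exprn_ge0 // lerDr
    exprn_ge0.
move: B; rewrite -E; set t := _ * (_ - _).
move: (green_trunc N s) (green_trunc n s) t (_^-1 : R) (_^-1 : R) (_^-1 : R) => a b t.
by move=> x y z; lra.
Qed.

Context (sigma : probability (borelRP2 R) R) (G : RP2 -> RP2 -> R)
  (G_green : is_green_function sigma G).

(** The weights P = (2n+1) cos2^n have mass 1, and their Green potential is a
    truncated kernel. Where cos2 > d the value of G x is below L = G x r + e/2;
    elsewhere P is at most D = (2n+1) d^n, so small that D C is at most e/2, where
    C is the integral of |G x| + |L|. *)
Lemma green_trunc_le_green_eventually (x r : RP2) (e : R) N : x != r -> 0 < e ->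
  exists2 n, (N <= n)%N & green_trunc n (cos2 x r) <= G x r + e.
Proof.
move=> xr e0; have [cG iG _ _] := G_green.
pose L := G x r + e / 2.
have GxL : \forall y \near r, G x y < L.
  have c : (fun y => G x y) @ r --> G x r.
    have nbhsr : Filter (nbhs r) by exact: nbhs_filter.
    have nbhsx : Filter (nbhs x) by exact: nbhs_filter.
    have h1 : (fun _ : RP2 => x) @ r --> x by apply: (@cvg_cst _ x _ _ nbhsr).
    have h2 : (fun y : RP2 => y) @ r --> r by exact: cvg_id.
    have h : (fun y : RP2 => (x, y)) @ r --> (x, r).
      exact: (@cvg_pair _ _ _ (nbhs r) (nbhs x) (nbhs r) _ _ _ _ _ h1 h2).
    exact: (cvg_comp _ (fun z : RP2 * RP2 => G z.1 z.2) h (cG x r xr)).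
  have L0 : G x r < L by rewrite /L; lra.
  exact: (cvgr_lt _ c).
have [d d01 dV] := nbhs_cos2 GxL.
pose C := \int[sigma]_y `|G x y| + `|L|.
have C0 : 0 <= C by rewrite addr_ge0 // Rintegral_ge0.
have [n Nn nC] := linear_geometric_small d01 C0 (divr_gt0 e0 (ltr0Sn R 1)) N.
exists n => //; set D := (n.*2.+1)%:R * d ^+ n in nC.
have d0 : 0 <= d by case/andP: d01 => /ltW.
have D0 : 0 <= D by rewrite mulr_ge0 // exprn_ge0.
pose P p := (n.*2.+1)%:R * cos2 p r ^+ n.
have P0 p : 0 <= P p by rewrite mulr_ge0 // exprn_ge0 // cos2_ge0.
have bP : bounded_borel P.
  apply: bounded_borelM; first exact: bounded_borel_cst.
  exact/bounded_borelX/bounded_borel_cos2.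
have iP : \int[sigma]_p P p = 1.
  rewrite RintegralZl ?(moment_cos2 G_green) ?mulfV ?pnatr_eq0 //.
  exact/bounded_borel_integrable/bounded_borelX/bounded_borel_cos2.
have iLP : sigma.-integrable setT (EFin \o (fun p => L * P p)).
  apply/bounded_borel_integrable/bounded_borelM => //; exact: bounded_borel_cst.
have iN : sigma.-integrable setT (EFin \o (fun p => `|G x p|)).
  exact: integrable_norm (iG x).
have iNL : sigma.-integrable setT (EFin \o (fun p => `|G x p| + `|L|)).
  apply: integrable_addf => //.
  exact/bounded_borel_integrable/bounded_borel_cst.
have iDNL : sigma.-integrable setT (EFin \o (fun p => D * (`|G x p| + `|L|))).
  rewrite (_ : _ \o _ = EFin \o (fun p => (`|G x p| + `|L|) * D)).
    by apply: integrable_mul_bounded => //; exact: bounded_borel_cst.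
  by apply/funext => p /=; rewrite mulrC.
have le p : G x p * P p <= L * P p + D * (`|G x p| + `|L|).
  have [dp|pd] := ltP d (cos2 p r).
    apply: (@le_trans _ _ (L * P p)); first by rewrite ler_wpM2r // ltW // dV.
    by rewrite lerDl mulr_ge0 // addr_ge0.
  rewrite -lerBlDl -mulrBl; apply: (@le_trans _ _ ((`|G x p| + `|L|) * P p)).
    rewrite ler_wpM2r //; apply: le_trans (ler_norm _) _.
    exact: ler_normB.
  rewrite mulrC ler_wpM2r ?addr_ge0 // /P /D ler_wpM2l // lerXn2r ?nnegrE //.
  exact: cos2_ge0.
have : \int[sigma]_p (G x p * P p) <=
    \int[sigma]_p (L * P p + D * (`|G x p| + `|L|)).
  apply: le_Rintegral => //; last exact: integrable_addf.
  by apply: integrable_mul_bounded => //; exact: iG.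
have iL : \int[sigma]_p (L * P p) = L.
  by rewrite RintegralZl ?iP ?mulr1 //; exact: bounded_borel_integrable.
have iD : \int[sigma]_p (D * (`|G x p| + `|L|)) = D * C.
  rewrite RintegralZl // RintegralD // ?Rintegral_cst1 //.
  exact/bounded_borel_integrable/bounded_borel_cst.
rewrite (green_potential_power G_green) RintegralD // iL iD => H.
by apply: le_trans H _; rewrite /L; lra.
Qed.

Lemma green_trunc_le_green (x r : RP2) N : x != r -> (0 < N)%N ->
  green_trunc N (cos2 x r) - (4 * N%:R)^-1 <= G x r.
Proof.
move=> xr N0; apply/ler_addgt0Pr => e e0.
have [n Nn nG] := green_trunc_le_green_eventually N xr e0.
apply: le_trans nG; apply: le_trans (green_trunc_tail (cos2_ge0 x r) N0 Nn).
by rewrite lerDl invr_ge0 mulr_ge0.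
Qed.

End LowerBound.

(** * Welch's inequality *)

Section Welch.
Context {R : realType}.
Local Notation RP2 := (RP2 R).

(** The coordinates of the tensor power of v, indexed by words. *)
Definition monomial m (a : {ffun 'I_m -> 'I_3}) (v : 'rV[R]_3) : R :=
  \prod_(s < m) v 0 (a s).

Lemma dotp_pow m (x y : 'rV[R]_3) :
  dotp x y ^+ m = \sum_(a : {ffun 'I_m -> 'I_3}) monomial a x * monomial a y.
Proof.
have -> : dotp x y ^+ m = \prod_(s < m) dotp x y by rewrite prodr_const card_ord.
rewrite [LHS]bigA_distr_bigA /=; apply: eq_bigr => a _.
by rewrite /monomial -big_split.
Qed.

(** The degree k.*2 is even, so the monomial is defined on the projective
    plane. *)
Lemma bounded_borel_monomial k (a : {ffun 'I_(k.*2) -> 'I_3}) :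
  bounded_borel (fun p : RP2 => monomial a (val (repr p))).
Proof.
split.
  apply: continuous_measurable_RP2; apply: even_continuous_RP2.
    have sm m (b : {ffun 'I_m -> 'I_3}) : smooth_on setT (monomial b).
      suff H (s : seq 'I_m) :
          smooth_on setT (fun v : 'rV[R]_3 => \prod_(i <- s) v 0 (b i)).
        exact: H.
      elim: s => [|i s IH].
        under eq_fun do rewrite big_nil.
        exact/smooth_on_cst/openT.
      under eq_fun do rewrite big_cons.
      apply: smooth_onM => //; first exact: openT.
      exact/smooth_on_coord/openT.
    by move=> v; apply: differentiable_continuous; exact: (sm _ a [::]).
  move=> v; rewrite /monomial; under eq_bigr do rewrite mxE -mulN1r.
  rewrite big_split /= prodr_const card_ord.
  by rewrite (_ : (-1) ^+ k.*2 = 1) ?mul1r // -mul2n exprM sqrrN !expr1n.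
exists 1 => p; rewrite normr_prod; apply: prodr_ile1 => s _.
rewrite normr_ge0 /= -(@ler_pXn2r _ 2) ?nnegrE // real_normK ?num_real // expr1n.
by rewrite -[leRHS](dotp_repr p); exact: coord_sq_le_dotp.
Qed.

Context (sigma : probability (borelRP2 R) R) (G : RP2 -> RP2 -> R)
  (G_green : is_green_function sigma G).

(** Among tensors of order 2k, let S be the mean of the tensor powers of unit
    vectors and T the sum of those of the points omega i. Then
    <S, S> = 1/(2k+1) and <S, T> = N/(2k+1), since the product of S with the
    power of a unit vector is a moment of cos2; the inequality is
    0 <= |T - N S|^2. *)
Lemma sum_cos2_pow_ge N (omega : 'I_N -> RP2) k :
  N%:R ^+ 2 / (k.*2.+1)%:R <=
  \sum_(i < N) \sum_(j < N) cos2 (omega i) (omega j) ^+ k.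
Proof.
pose M a (p : RP2) := @monomial k.*2 a (val (repr p)).
pose S a := \int[sigma]_p M a p.
pose T a := \sum_(i < N) M a (omega i).
pose m : R := (k.*2.+1)%:R^-1.
have bM a : bounded_borel (M a) by exact: bounded_borel_monomial.
have cosE p q : cos2 p q ^+ k = \sum_a M a p * M a q.
  by rewrite /cos2 -exprM mul2n dotp_pow.
have SM q : \sum_a S a * M a q = m.
  rewrite /m -(moment_cos2 G_green k q).
  under [RHS]eq_Rintegral do rewrite cosE.
  rewrite Rintegral_bounded_sum => [|a].
    by apply: eq_bigr => a _; rewrite RintegralZr //; exact: bounded_borel_integrable.
  by apply: bounded_borelM => //; exact: bounded_borel_cst.
have SS : \sum_a S a * S a = m.
  rewrite -[RHS](Rintegral_cst1 sigma).
  under [RHS]eq_Rintegral => p _ do rewrite -(SM p).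
  rewrite Rintegral_bounded_sum => [|a].
    by apply: eq_bigr => a _; rewrite RintegralZl //; exact: bounded_borel_integrable.
  by apply: bounded_borelM => //; exact: bounded_borel_cst.
have ST : \sum_a S a * T a = N%:R * m.
  under eq_bigr do rewrite mulr_sumr.
  rewrite exchange_big /=; under eq_bigr do rewrite SM.
  by rewrite sumr_const card_ord mulr_natl.
have TT : \sum_a T a * T a = \sum_(i < N) \sum_(j < N) cos2 (omega i) (omega j) ^+ k.
  under eq_bigr do rewrite mulr_suml.
  rewrite exchange_big /=; apply: eq_bigr => i _.
  under eq_bigr do rewrite mulr_sumr.
  by rewrite exchange_big /=; apply: eq_bigr => j _; rewrite cosE.
have : 0 <= \sum_a (T a - N%:R * S a) ^+ 2 by apply: sumr_ge0 => a _; exact: sqr_ge0.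
have -> : \sum_a (T a - N%:R * S a) ^+ 2 =
   \sum_a T a * T a - 2 * N%:R * (\sum_a S a * T a) + N%:R ^+ 2 * \sum_a S a * S a.
  rewrite !mulr_sumr -sumrB -big_split /=; apply: eq_bigr => a _; ring.
by rewrite TT ST SS -/m => H; rewrite -subr_ge0; apply: le_trans H _; nra.
Qed.

Lemma sum_green_trunc_ge0 N (omega : 'I_N -> RP2) n :
  0 <= \sum_(i < N) \sum_(j < N) green_trunc n (cos2 (omega i) (omega j)).
Proof.
have -> : \sum_(i < N) \sum_(j < N) green_trunc n (cos2 (omega i) (omega j)) =
  \sum_(l < n) (\sum_(i < N) \sum_(j < N) cos2 (omega i) (omega j) ^+ l.+1
                - N%:R ^+ 2 / (l.*2.+3)%:R) / (l.*2.+2)%:R.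
  under eq_bigr do rewrite exchange_big.
  rewrite exchange_big /=; apply: eq_bigr => l _.
  under eq_bigr do rewrite -mulr_suml.
  rewrite -mulr_suml; congr (_ / _).
  under [LHS]eq_bigr do rewrite sumrB.
  rewrite sumrB; congr (_ - _).
  by rewrite !sumr_const card_ord -mulrnA -[LHS]mulr_natl natrM expr2.
apply: sumr_ge0 => l _; apply: mulr_ge0 => //.
by rewrite subr_ge0 -doubleS; exact: sum_cos2_pow_ge.
Qed.

(** Half the harmonic number, the increments of which are bounded through
    1/(n+1) <= - ln (1 - 1/(n+1)) = ln (n+1) - ln n. *)
Lemma green_trunc1_le n : (0 < n)%N -> green_trunc n (1 : R) <= (1 + ln n%:R) / 2.
Proof.
case: n => // n _; elim: n => [|n IH].
  rewrite green_truncS /green_trunc big_ord0 add0r ln1 addr0 expr1n mulrC.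
  by rewrite ler_wpM2r ?invr_ge0 // gerBl.
rewrite green_truncS expr1n.
have n0 : 0 < n.+1%:R :> R by rewrite ltr0n.
have n20 : 0 < n.+2%:R :> R by rewrite ltr0n.
have lnE : ln n.+1%:R <= ln n.+2%:R - n.+2%:R^-1 :> R.
  rewrite (_ : n.+1%:R = n.+2%:R * (1 + - n.+2%:R^-1)); last first.
    by rewrite mulrDr mulr1 mulrN mulfV ?lt0r_neq0 // -(natr1 n.+1) addrK.
  have lt1 : n.+2%:R^-1 < 1 :> R by rewrite invf_lt1 // ltr1n.
  rewrite lnM ?posrE ?subr_gt0 // lerD2l; apply: le_ln1Dx.
  by rewrite ltrN2.
have tE : (n.+1.*2.+2)%:R^-1 * (1 - (n.+1.*2.+3)%:R^-1) <= n.+2%:R^-1 / 2 :> R.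
  rewrite -doubleS -muln2 natrM invfM; apply: ler_piMr.
    by apply: mulr_ge0; rewrite invr_ge0.
  by rewrite gerBl invr_ge0.
move: IH lnE tE; set t := _ * (1 - _).
by move: (green_trunc _ _) (ln _) (ln _) (n.+2%:R^-1 : R) t => a b c y t; lra.
Qed.

End Welch.

(** * The energy bound *)

Theorem theorem4p13 (R : realType) (sigma : probability (borelRP2 R) R)
    (G : RP2 R -> RP2 R -> R)
    (sigma_inv : isometry_invariant sigma)
    (G_green : is_green_function sigma G) :
  exists C_G : R, 0 < C_G /\
    forall N : nat, (2 <= N)%N ->
    forall omega : 'I_N -> RP2 R, injective omega ->
      - (1 / 2) * N%:R * ln N%:R - C_G * N%:R <= green_energy G omega.
Proof.
exists (3 / 4); split=> [|N N2 omega omega_inj]; first by rewrite divr_gt0.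
have N0 : (0 < N)%N by exact: ltnW.
have N0R : 0 < N%:R :> R by rewrite ltr0n.
pose K i j := green_trunc N (cos2 (omega i) (omega j)).
have GK i : \sum_(j < N) K i j - green_trunc N (1 : R) - 1 / 4 <=
    \sum_(j < N | j != i) G (omega i) (omega j).
  (* The N - 1 errors 1/(4N) add up to at most 1/4. *)
  apply: (@le_trans _ _ (\sum_(j < N | j != i) (K i j - (4 * N%:R)^-1))).
    rewrite sumrB [X in X - _ - _](bigD1 i) //=.
    rewrite (_ : K i i = green_trunc N 1); last by rewrite /K cos2pp.
    rewrite (addrC (green_trunc N 1)) addrK lerD2l lerN2.
    rewrite (_ : 1 / 4 = \sum_(j < N) (4 * N%:R)^-1).
      by rewrite [leRHS](bigD1 i) //= lerDr invr_ge0 mulr_ge0.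
    by rewrite sumr_const card_ord -mulr_natl; field; exact: lt0r_neq0.
  apply: ler_sum => j ji; apply: (green_trunc_le_green G_green) => //.
  by rewrite (inj_eq omega_inj) eq_sym.
have sumK : \sum_(i < N) (\sum_(j < N) K i j - green_trunc N (1 : R) - 1 / 4) =
    \sum_(i < N) \sum_(j < N) K i j - N%:R * (green_trunc N 1 + 1 / 4).
  under [LHS]eq_bigr do rewrite -addrA -opprD.
  by rewrite sumrB sumr_const card_ord [in RHS]mulr_natl.
rewrite /green_energy; apply: le_trans (ler_sum _ (fun i _ => GK i)).
rewrite sumK.
have K0 := @sum_green_trunc_ge0 R sigma G G_green N omega N.
have T1 := ler_wpM2l (ltW N0R) (@green_trunc1_le R N N0).
rewrite -/(K _ _) in K0.
apply: (@le_trans _ _ (0 - N%:R * (green_trunc N 1 + 1 / 4))); last by rewrite lerD2r.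
move: T1; move: (green_trunc N 1) (ln _) => t l T1; nra.
Qed.
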